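(* For every $\Lambda>0$ there exists a positive radial solution $u$ of $$\Delta^3u=-\frac{1}{u^3}\quad\text{in }\mathbb{R}^3$$ such that $$\int_{\mathbb{R}^3}\frac{dx}{u^2(x)}=\Lambda.$$
   Context: Solutions are smooth functions defined on all of $\mathbb{R}^3$ (entire solutions). *)

(* Defs.v *)
From HB Require Import structures.
From mathcomp Require Import all_boot all_order all_algebra.
From mathcomp Require Import all_classical all_reals all_analysis.
Set Implicit Arguments. Unset Strict Implicit. Unset Printing Implicit Defensive.
Import Order.TTheory GRing.Theory Num.Theory.
Import numFieldNormedType.Exports.
Local Open Scope ring_scope.

Section Defs.
Variable R : realType.

Definition R3 := ((R * R) * R)%type.

Definition coord (i : 'I_3) (p : R3) : R :=
  match val i with 0%N => p.1.1 | 1%N => p.1.2 | _ => p.2 end.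

Definition setc (i : 'I_3) (p : R3) (t : R) : R3 :=
  match val i with
  | 0%N => ((t, p.1.2), p.2)
  | 1%N => ((p.1.1, t), p.2)
  | _ => (p.1, t)
  end.

Definition partial (i : 'I_3) (u : R3 -> R) : R3 -> R :=
  fun p => derive1 (fun t => u (setc i p t)) (coord i p).

Definition iter_partials (l : seq 'I_3) (u : R3 -> R) : R3 -> R :=
  foldr partial u l.

Definition smooth (u : R3 -> R) : Prop :=
  forall l : seq 'I_3,
    continuous (iter_partials l u) /\
    forall (i : 'I_3) (p : R3),
      derivable (fun t => iter_partials l u (setc i p t)) (coord i p) 1.

Definition laplacian (u : R3 -> R) : R3 -> R :=
  fun p => \sum_(i < 3) partial i (partial i u) p.

Definition sqnorm3 (p : R3) : R := p.1.1 ^+ 2 + p.1.2 ^+ 2 + p.2 ^+ 2.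

Definition radial (u : R3 -> R) : Prop :=
  forall p q : R3, sqnorm3 p = sqnorm3 q -> u p = u q.

Definition lebesgue3 :=
  ((@lebesgue_measure R \x @lebesgue_measure R) \x @lebesgue_measure R)%E.

End Defs.
Arguments lebesgue3 R : clear implicits.

(* Main.v *)
Require Import Defs.
From HB Require Import structures.
From mathcomp Require Import all_boot all_order all_algebra.
From mathcomp Require Import ring lra.
From mathcomp Require Import all_classical all_reals all_analysis measurable_realfun.
Import Order.TTheory GRing.Theory Num.Theory.
Import numFieldNormedType.Exports.
Local Open Scope ring_scope.
Set Implicit Arguments.
Unset Strict Implicit.

(* In terms of s = |x|^2 the Laplacian of a radial function g(|x|^2) is 4 s g'' + 6 g'.  Its third
   power is inverted by K f (s) = s^3 int_0^1 t (1 - t)^5 / 120 f(s t^2) dt, a formula that makes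
   sense for all real s, so that g is constructed as a smooth function on the whole line and
   smoothness of g(|x|^2) at the origin is automatic.

   The equation is invariant under u |-> l^(-3/2) u(l x), and so is the integral of u^-2; hence
   one varies the shape.  With P(s) = e^2 + (1 - s)^2, which nearly touches 0 on the unit sphere,
   one solves g = P - d K(g^-3) by contraction in the weighted norm sup |g| / P; this works for
   0 <= d <= c e^5 because |K(P^-3)| <= P / (15 e^5).  Then u = d^(-1/4) g(|x|^2) solves the
   problem and has mass d^(1/2) int g^-2, which depends continuously on d, vanishes at d = 0, and
   at d = c e^5 is at least of order e^(5/2) int P^-2 ~ e^(-1/2), which is as large as we like. *)

(** * Weighted averages over dilations *)

(** In dimension three [r Lap u = (r u)''], so inverting the cubed Laplacian on radial functions is
    a sixfold integration: [r u(r) = int_0^r (r - rho)^5 / 5! rho f(rho^2) drho]. The substitution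
    [rho = r t], [s = r^2] turns this into K.

    P is quadratic in s, hence annihilated by the cubed Laplacian, so a fixed point satisfies
    [Lap^3 g = - d g^-3]. Measuring deviations relative to P is what makes the contraction close: on
    [g >= P / 2] a relative error [c] in [g] becomes an error at most [48 c P^-3] in [g^-3]. The
    single function K(P^-3) thus controls existence, contraction and the dependence on d.

    The exponents come from the shell around the unit sphere, of width of order e, on which P is of
    order e^2. K integrates [P^-3 ~ e^-6] across that width, whence e^-5; the integral of
    [P^-2 ~ e^-4] is at least of order e^-3. The admissible size of d enters the mass only through
    its square root, so it costs less than the shell gains. *)

Section Averages.
Context {R : realType}.
Implicit Types (f g phi psi : R -> R) (w : {poly R}) (s t x : R).

Definition int01 phi : R := (\int[@lebesgue_measure R]_(t in `[0%R, 1%R]) phi t)%R.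

Lemma continuous_integrable01 phi : continuous phi ->
  (@lebesgue_measure R).-integrable `[0%R, 1%R]%classic (EFin \o phi).
Proof.
move=> c; apply: continuous_compact_integrable; first exact: segment_compact.
exact: continuous_subspaceT.
Qed.

Lemma eq_int01 phi psi : (forall t, 0 <= t <= 1 -> phi t = psi t) -> int01 phi = int01 psi.
Proof. by move=> e; apply: eq_Rintegral => t; rewrite inE/= in_itv; exact: e. Qed.

Lemma int01D phi psi : continuous phi -> continuous psi ->
  int01 (fun t => phi t + psi t) = int01 phi + int01 psi.
Proof. by move=> c1 c2; apply: RintegralD => //; exact: continuous_integrable01. Qed.

Lemma int01B phi psi : continuous phi -> continuous psi ->
  int01 (fun t => phi t - psi t) = int01 phi - int01 psi.
Proof. by move=> c1 c2; apply: RintegralB => //; exact: continuous_integrable01. Qed.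

Lemma int01Z c phi : continuous phi -> int01 (fun t => c * phi t) = c * int01 phi.
Proof. by move=> c1; apply: RintegralZl => //; exact: continuous_integrable01. Qed.

Lemma le_int01 phi psi : continuous phi -> continuous psi ->
  (forall t, 0 <= t <= 1 -> phi t <= psi t) -> int01 phi <= int01 psi.
Proof.
move=> c1 c2 h; apply: le_Rintegral => //; exact: continuous_integrable01.
Qed.

Lemma continuous_norm_comp phi : continuous phi -> continuous (fun t => `|phi t|).
Proof. by move=> c t; exact: (cvg_norm (c t)). Qed.

Lemma norm_int01_le phi : continuous phi -> `|int01 phi| <= int01 (fun t => `|phi t|).
Proof. by move=> c; apply: le_normr_Rintegral => //; exact: continuous_integrable01. Qed.

Lemma int01_cst c : int01 (fun=> c) = c.
Proof.
rewrite /int01 Rintegral_cst//=.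
by rewrite lebesgue_measure_itv /= lte_fin ltr01 -EFinD subr0 /= mulr1.
Qed.

Lemma is_derive_mul f g x (a b c : R) : is_derive x (1:R) f a -> is_derive x (1:R) g b ->
  c = a * g x + f x * b -> is_derive x (1:R) (fun y => f y * g y) c.
Proof.
move=> df dg ->; have := is_deriveM df dg => h.
by apply: is_derive_eq; rewrite /GRing.scale /= addrC (mulrC a).
Qed.

Lemma is_derive_add f g x (a b c : R) : is_derive x (1:R) f a -> is_derive x (1:R) g b ->
  c = a + b -> is_derive x (1:R) (fun y => f y + g y) c.
Proof. by move=> df dg ->; exact: is_deriveD. Qed.

Lemma is_derive_compose f g x (a b c : R) : is_derive (g x) (1:R) f a ->
  is_derive x (1:R) g b -> c = a * b -> is_derive x (1:R) (fun y => f (g y)) c.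
Proof. by move=> df dg ->; exact: (is_derive1_comp df dg). Qed.

Lemma is_derive_scale f x (k a c : R) : is_derive x (1:R) f a ->
  c = k * a -> is_derive x (1:R) (fun y => k * f y) c.
Proof.
move=> df ->; apply: (is_derive_mul (is_derive_cst k x 1) df).
by rewrite mul0r add0r.
Qed.

Lemma derivable_continuous f : (forall x, derivable f x 1) -> continuous f.
Proof. by move=> d x; apply/differentiable_continuous/derivable1_diffP. Qed.

Lemma int01_derive (Phi phi : R -> R) : continuous phi ->
  (forall t, is_derive t (1:R) Phi (phi t)) -> int01 phi = Phi 1 - Phi 0.
Proof.
move=> c d; rewrite /int01 /Rintegral (@continuous_FTC2 _ _ Phi) //.
- exact: continuous_subspaceT.
- have cP : continuous Phi by apply: derivable_continuous => x; exact: ex_derive.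
  split=> //.
  + by apply: cvg_at_right_filter; exact: cP.
  + by apply: cvg_at_left_filter; exact: cP.
- by move=> x _; rewrite derive1E derive_val.
Qed.

Lemma continuous_bounded f (A : R) : continuous f ->
  exists2 C : R, 0 <= C & forall x, `|x| <= A -> `|f x| <= C.
Proof.
move=> cf; have [A0|A0] := ltP A 0.
  by exists 0 => // x /le_lt_trans/(_ A0); rewrite ltNge normr_ge0.
have AA : -A <= A by lra.
have [c _ h] := @EVT_max R (fun x => `|f x|) _ _ AA
  (continuous_subspaceT (continuous_norm_comp cf)).
exists `|f c| => // x xA; apply: h.
by rewrite in_itv/= -ler_norml.
Qed.

(** Rescaling to the fixed interval [[0, 1]] leaves a kernel independent of [s]: all dependence on
    [s] sits inside [f], so neither [s = 0] nor [s < 0] is special. Polynomial weights are stable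
    under all the operations below. *)
Definition davg w f s : R := int01 (fun t => w.[t] * f (s * t ^+ 2)).

Lemma continuous_scale2 f s : continuous f -> continuous (fun t => f (s * t ^+ 2)).
Proof.
move=> cf t; apply: (@continuous_comp _ _ _ (fun t => s * t ^+ 2) f); last exact: cf.
apply: continuousM; [exact: cst_continuous|exact: exprn_continuous].
Qed.

Lemma continuous_horner_scale2 w f s : continuous f ->
  continuous (fun t => w.[t] * f (s * t ^+ 2)).
Proof.
move=> cf t; apply: continuousM; first exact: continuous_horner.
exact: continuous_scale2.
Qed.

Lemma continuous_dilation f (a b : R) : continuous f ->
  continuous (fun s => a * f (s * b)).
Proof.
move=> cf s; apply: continuousM; first exact: cst_continuous.
apply: (@continuous_comp _ _ _ (fun x : R => x * b) f _ _ (cf _)).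
by apply: continuousM => //; exact: cst_continuous.
Qed.

Lemma norm_scale2_le s t A : `|s| <= A -> 0 <= t <= 1 -> `|s * t ^+ 2| <= A.
Proof.
move=> sA /andP[t0 t1]; rewrite normrM (ger0_norm (exprn_ge0 2 t0)).
by rewrite (le_trans _ sA) // ler_piMr // exprn_ile1.
Qed.

Lemma continuous_davg w f : continuous f -> continuous (davg w f).
Proof.
move=> cf s.
have [C1 C10 h1] := @continuous_bounded (horner w) 1 (@continuous_horner _ w).
have [C2 C20 h2] := @continuous_bounded f (`|s| + 1) cf.
(* Domination is local: for [x] within 1 of [s] the arguments [x * t ^+ 2] stay where [f] is bounded
   by [C2]. *)
have H : {in `](s - 1), (s + 1)[%classic, continuous (davg w f)}.
  apply: (@continuity_under_integral _ _ _ lebesgue_measure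
    (fun s t => w.[t] * f (s * t ^+ 2)) _ _ _ _ _ _ (fun=> C1 * C2)).
  - exact: measurable_itv.
  - by move=> x _; apply: continuous_integrable01; exact: continuous_horner_scale2.
  - by apply: aeW => t _ x _; exact: continuous_dilation.
  - by apply: continuous_integrable01; exact: cst_continuous.
  - move=> x; rewrite /= in_itv/= => xI; apply: aeW => t; rewrite /= in_itv/= => tI.
    rewrite normrM ler_pM //.
      by apply: h1; have /andP[t0 t1] := tI; rewrite ger0_norm.
    apply/h2/norm_scale2_le => //.
    have -> : x = s + (x - s) by ring.
    apply: (le_trans (ler_normD _ _)); rewrite lerD2l ler_norml; lra.
by apply: H; rewrite inE /= in_itv /=; lra.
Qed.

(** Each differentiation in [s] of [f (s * t ^+ 2)] produces a factor [t ^+ 2], which the weight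
    absorbs; the result is again an average, so the lemma iterates. *)
Lemma is_derive_davg w f f' : (forall x, is_derive x (1:R) f (f' x)) -> continuous f' ->
  forall s, is_derive s (1:R) (davg w f) (davg ('X^2 * w) f' s).
Proof.
move=> df cf' s.
have cf : continuous f by apply: derivable_continuous => x; exact: ex_derive.
have [C1 C10 h1] := @continuous_bounded (horner ('X^2 * w)) 1 (@continuous_horner _ _).
have [C2 C20 h2] := @continuous_bounded f' (`|s| + 1) cf'.
have dft x t : is_derive x (1:R) (fun x => w.[t] * f (x * t ^+ 2))
    (('X^2 * w).[t] * f' (x * t ^+ 2)).
  have h : is_derive x (1:R) (fun x => x * t ^+ 2) (t ^+ 2).
    by apply: (is_derive_mul (is_derive_id x 1) (is_derive_cst (t ^+ 2) x 1)); rewrite /= mul1r mulr0 addr0.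
  apply: (is_derive_scale (k := w.[t]) (is_derive_compose (df _) h erefl)).
  by rewrite !hornerE /=; ring.
have Is : `](s - 1), (s + 1)[%classic s by rewrite /= in_itv/=; lra.
have gb : forall x y : R, `](s - 1), (s + 1)[%classic x -> `[0%R, 1%R]%classic y ->
    `|partial1of2 (fun x t => w.[t] * f (x * t ^+ 2)) x y| <= C1 * C2.
  move=> x t; rewrite /= !in_itv/= => xI tI.
  rewrite /partial1of2 derive1E (@derive_val _ _ _ _ _ _ _ (dft x t)).
  rewrite normrM ler_pM //.
    by apply: h1; have /andP[t0 t1] := tI; rewrite ger0_norm.
  apply/h2/norm_scale2_le => //.
  have -> : x = s + (x - s) by ring.
  apply: (le_trans (ler_normD _ _)); rewrite lerD2l ler_norml; lra.
have i1 : forall x : R, `](s - 1), (s + 1)[%classic x ->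
  (@lebesgue_measure R).-integrable `[0%R, 1%R]%classic
    (EFin \o (fun t => w.[t] * f (x * t ^+ 2))).
  by move=> x _; apply: continuous_integrable01; exact: continuous_horner_scale2.
have d1 : forall x y : R, `](s - 1), (s + 1)[%classic x -> `[0%R, 1%R]%classic y ->
    derivable ((fun x t => w.[t] * f (x * t ^+ 2)) ^~ y) x 1.
  by move=> x t _ _; have := dft x t => ?; exact: ex_derive.
have ig : (@lebesgue_measure R).-integrable `[0%R, 1%R]%classic
    (EFin \o (fun=> C1 * C2)).
  by apply: continuous_integrable01; exact: cst_continuous.
have C0 : forall y : R, 0 <= C1 * C2 by move=> _; exact: mulr_ge0.
have ME : davg w f = fun s => int01 (fun t => w.[t] * f (s * t ^+ 2)) by [].
apply: DeriveDef; rewrite ME.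
  by apply: (derivable_under_integral (mu := @lebesgue_measure R)
    (f := fun s t => w.[t] * f (s * t ^+ 2)) _ Is i1 d1 C0 ig gb).
rewrite -derive1E [LHS](differentiation_under_integral (mu := @lebesgue_measure R)
  (f := fun s t => w.[t] * f (s * t ^+ 2)) _ Is i1 d1 C0 ig gb) //.
apply: eq_Rintegral => t _.
by rewrite /partial1of2 derive1E (@derive_val _ _ _ _ _ _ _ (dft s t)).
Qed.

End Averages.

(** * Finite differentiability and the radial Laplacian *)

Section Regularity.
Context {R : realType}.
Implicit Types (f g : R -> R) (w : {poly R}) (s t x : R) (n k : nat).

(** Class C^n on the whole line, in recursive form so that each closure property follows by
    induction from one derivative formula. *)
Fixpoint diffn n f : Prop :=
  if n is m.+1 then (forall x, derivable f x 1) /\ diffn m (f^`()%classic) else continuous f.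

Lemma diffn_derive n f f' : (forall x, is_derive x (1:R) f (f' x)) -> diffn n f' -> diffn n.+1 f.
Proof.
move=> d c; split; first by move=> x; have := d x => ?; exact: ex_derive.
suff -> : (f^`()%classic) = f' by [].
by apply/funext => x; rewrite derive1E (@derive_val _ _ _ _ _ _ _ (d x)).
Qed.

Lemma diffn_is_derive n f x : diffn n.+1 f -> is_derive x (1:R) f (f^`()%classic x).
Proof. by case=> d _; apply: DeriveDef; rewrite ?derive1E. Qed.

Lemma diffn_continuous n f : diffn n f -> continuous f.
Proof. by case: n => [//|n] [d _]; exact: derivable_continuous. Qed.

Lemma diffnS n f : diffn n.+1 f -> diffn n f.
Proof.
elim: n f => [|n IH] f; first exact: (@diffn_continuous 1).
by move=> [d c]; split=> //; exact: IH.
Qed.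

Lemma diffn_cst n (c : R) : diffn n (fun=> c).
Proof.
elim: n c => [|n IH] c; first exact: cst_continuous.
exact: (diffn_derive (f' := fun=> 0) (fun x => is_derive_cst c x 1) (IH 0)).
Qed.

Lemma diffn_id n : diffn n (fun x => x).
Proof.
case: n => [|n]; first by move=> x.
exact: (diffn_derive (f' := fun=> 1) (fun x => is_derive_id x 1) (diffn_cst n 1)).
Qed.

Lemma diffnD n f g : diffn n f -> diffn n g -> diffn n (fun x => f x + g x).
Proof.
elim: n f g => [|n IH] f g; first by move=> cf cg x; exact: continuousD (cf x) (cg x).
move=> cf cg; apply: (@diffn_derive n (fun x => f x + g x) (fun x => f^`()%classic x + g^`()%classic x)).
  by move=> x; apply: (is_derive_add (diffn_is_derive x cf) (diffn_is_derive x cg)).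
by apply: IH; [case: cf|case: cg].
Qed.

Lemma diffnM n f g : diffn n f -> diffn n g -> diffn n (fun x => f x * g x).
Proof.
elim: n f g => [|n IH] f g; first by move=> cf cg x; exact: continuousM (cf x) (cg x).
move=> cf cg.
apply: (@diffn_derive n (fun x => f x * g x)
  (fun x => f^`()%classic x * g x + f x * g^`()%classic x)).
  by move=> x; apply: (is_derive_mul (diffn_is_derive x cf) (diffn_is_derive x cg)).
by apply: diffnD; apply: IH; try exact: diffnS; [case: cf|case: cg].
Qed.

Lemma diffnZ n (c : R) f : diffn n f -> diffn n (fun x => c * f x).
Proof. by move=> cf; apply: diffnM => //; exact: diffn_cst. Qed.

Lemma diffnB n f g : diffn n f -> diffn n g -> diffn n (fun x => f x - g x).
Proof.
move=> cf cg; have := diffnD cf (diffnZ (-1) cg).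
by congr diffn; apply/funext => x; rewrite mulN1r.
Qed.

Lemma diffnX n k f : diffn n f -> diffn n (fun x => f x ^+ k).
Proof.
move=> cf; elim: k => [|k IH].
  have -> : (fun x => f x ^+ 0) = fun=> 1 by apply/funext => x; rewrite expr0.
  exact: diffn_cst.
have -> : (fun x => f x ^+ k.+1) = fun x => f x * f x ^+ k.
  by apply/funext => x; rewrite exprS.
exact: diffnM.
Qed.

Lemma diffnV n f : (forall x, f x != 0) -> diffn n f -> diffn n (fun x => (f x)^-1).
Proof.
move=> f0; elim: n f f0 => [|n IH] f f0; first by move=> cf x; exact: continuousV (f0 x) (cf x).
move=> cf.
apply: (@diffn_derive n (fun x => (f x)^-1) (fun x => - 1 * (f^`()%classic x * ((f x)^-1) ^+ 2))).
  move=> x; have := diffn_is_derive x cf => dx.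
  have := is_deriveV (f0 x) dx => h; apply: is_derive_eq.
  by rewrite /GRing.scale /= exprVn mulN1r mulNr mulrC.
apply/diffnZ/diffnM; first by case: cf.
by apply/diffnX/IH => //; exact: diffnS.
Qed.

Lemma diffn_davg n w f : diffn n f -> diffn n (davg w f).
Proof.
elim: n w f => [|n IH] w f; first exact: continuous_davg.
move=> cf; have cf' : diffn n (f^`()%classic) by case: cf.
apply: (diffn_derive (f' := davg ('X^2 * w) (f^`()%classic))); last exact: IH.
by move=> x; apply: is_derive_davg (diffn_continuous cf') _ => y; exact: diffn_is_derive cf.
Qed.

Lemma eq_diffn n f g : f =1 g -> diffn n f -> diffn n g.
Proof. by move=> /funext ->. Qed.

Lemma eq_davg w v f s : (forall t, w.[t] = v.[t]) -> davg w f s = davg v f s.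
Proof. by move=> e; apply: eq_int01 => t _; rewrite e. Qed.

Lemma davg_lin (a b : R) w v f s : continuous f ->
  davg (a *: w + b *: v) f s = a * davg w f s + b * davg v f s.
Proof.
move=> cf; have c u : continuous (fun t => u.[t] * f (s * t ^+ 2)) := continuous_horner_scale2 cf.
have cZ (e : R) u : continuous (fun t => e * (u.[t] * f (s * t ^+ 2))).
  by move=> t; exact: continuousM (@cst_continuous _ _ e t) (c u t).
rewrite /davg -(int01Z a (c w)) -(int01Z b (c v)) -(int01D (cZ a w) (cZ b v)).
by apply: eq_int01 => t _; rewrite !hornerE /=; ring.
Qed.

(* The Euler field [s d/ds] acts on [s^k davg w f] through the weight alone, as
   [s d/ds f(s t^2) = (t/2) d/dt f(s t^2)] can be integrated by parts. *)
Definition euler_weight k w : {poly R} := k%:R *: w - 2^-1 *: ('X * w)^`()%R.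

(** The function differentiated in [t] is [t w(t) f(s t^2)]. Its extra factor [t] kills the boundary
    term at 0, and the one at 1 is [w.[1] * f s]. *)
Lemma davg_by_parts w f s : diffn 1 f ->
  s * davg ('X^2 * w) (f^`()%classic) s =
  2^-1 * (w.[1] * f s - davg (('X * w)^`()%R) f s).
Proof.
move=> cf; have cf' : continuous (f^`()%classic) by case: cf.
have c0 := diffn_continuous cf.
pose h t := (('X * w)^`()%R).[t] * f (s * t ^+ 2) +
  2 * s * (('X^2 * w).[t] * f^`()%classic (s * t ^+ 2)).
have c1 : continuous (fun t => (('X * w)^`()%R).[t] * f (s * t ^+ 2)).
  exact: continuous_horner_scale2.
have c3 : continuous (fun t => ('X^2 * w).[t] * f^`()%classic (s * t ^+ 2)).
  exact: continuous_horner_scale2.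
have c2 := @diffnZ 0 (2 * s) _ c3.
have ch : continuous h := @diffnD 0 _ _ c1 c2.
have dh t : is_derive t (1:R) (fun t => ('X * w).[t] * f (s * t ^+ 2)) (h t).
  have d1 : is_derive t (1:R) (fun t => s * t ^+ 2) (s * (t + t)).
    apply: (is_derive_scale (k := s) (is_derive_mul (is_derive_id t 1) (is_derive_id t 1) erefl)).
    by rewrite /= mul1r mulr1.
  have d2 := is_derive_compose (g := fun t => s * t ^+ 2) (diffn_is_derive _ cf) d1 erefl.
  apply: (is_derive_mul (is_derive_poly ('X * w) t) d2).
  by rewrite /h !hornerE /=; ring.
have := int01_derive ch dh; rewrite /h (int01D c1 c2) (int01Z _ c3).
rewrite !hornerM !hornerX expr1n mulr1 mul1r !mul0r subr0 /davg => <-.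
by field.
Qed.

Lemma is_derive_pow n x : is_derive x (1:R) (fun y => y ^+ n) (n%:R * x ^+ n.-1).
Proof.
have -> : (fun y => y ^+ n) = horner ('X^n : {poly R}).
  by apply/funext => y; rewrite hornerXn.
by have := is_derive_poly ('X^n : {poly R}) x; rewrite derivXn hornerMn hornerXn mulr_natl.
Qed.

Lemma is_derive_pow_davg k w f s : diffn 1 f ->
  is_derive s (1:R) (fun s => s ^+ k.+1 * davg w f s)
    (s ^+ k * (davg (euler_weight k.+1 w) f s + w.[1] / 2 * f s)).
Proof.
move=> cf; have cf' : continuous (f^`()%classic) by case: cf.
have c0 := diffn_continuous cf.
have dM := is_derive_davg w (fun x => diffn_is_derive x cf) cf' s.
apply: (is_derive_mul (is_derive_pow k.+1 s) dM).
rewrite -[k.+1.-1]/k exprSr -[s ^+ k * s * _]mulrA (davg_by_parts w s cf).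
by rewrite /euler_weight -scaleNr davg_lin //; field.
Qed.

(** For a weight vanishing at 1 the boundary term disappears, and the derivative is an average of
    [f] itself with one power of [s] less. No derivative of [f] occurs in it. *)
Lemma is_derive_pow_davg0 k w f s : diffn 1 f -> w.[1] = 0 ->
  is_derive s (1:R) (fun s => s ^+ k.+1 * davg w f s) (s ^+ k * davg (euler_weight k.+1 w) f s).
Proof. by move=> cf w1; have := is_derive_pow_davg k w s cf; rewrite w1 !mul0r addr0. Qed.

Definition radial_laplacian g s : R :=
  4 * s * (g^`())^`()%classic s + 6 * g^`()%classic s.

Lemma derive1_is_derive f f' : (forall x, is_derive x (1:R) f (f' x)) ->
  f^`()%classic = f'.
Proof.
by move=> d; apply/funext => x; rewrite derive1E (@derive_val _ _ _ _ _ _ _ (d x)).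
Qed.

(** The first derivative has no boundary term because [w.[1] = 0]; the second contributes half the
    value at 1 of the new weight, and the factor 4 of the Laplacian turns this into the coefficient
    2 of [f s]. *)
Lemma radial_laplacian_pow_davg k w v f : diffn 1 f -> w.[1] = 0 ->
  (forall t, v.[t] = 4 * (euler_weight k (euler_weight k.+1 w)).[t]
                     + 6 * (euler_weight k.+1 w).[t]) ->
  radial_laplacian (fun s => s ^+ k.+1 * davg w f s) =
  fun s => s ^+ k * (davg v f s + 2 * (euler_weight k.+1 w).[1] * f s).
Proof.
move=> cf w1 hv; have c0 := diffn_continuous cf.
have d1 := derive1_is_derive (fun s => is_derive_pow_davg0 k s cf w1).
rewrite /radial_laplacian d1; apply/funext => s.
set w' := euler_weight k.+1 w in hv *.
have -> : davg v f s = 4 * davg (euler_weight k w') f s + 6 * davg w' f s.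
  by rewrite -davg_lin //; apply: eq_davg => t; rewrite hv !hornerE.
suff -> : 4 * s * (fun s => s ^+ k * davg w' f s)^`()%classic s =
    s ^+ k * (4 * davg (euler_weight k w') f s + 2 * w'.[1] * f s) by ring.
(* For [k = 0] no power of [s] is left to differentiate; there the factor [s] in front of the second
   derivative is what allows integration by parts. *)
move: (w') => {hv d1}v'; case: k w' => [|k] _ /=.
  have dM x := is_derive_davg v' (fun x => diffn_is_derive x cf) (proj2 cf) x.
  have -> : (fun s => s ^+ 0 * davg v' f s) = davg v' f.
    by apply/funext => x; rewrite expr0 mul1r.
  rewrite (derive1_is_derive dM) -mulrA (davg_by_parts v' s cf).
  by rewrite /euler_weight -scaleNr davg_lin //; field.
rewrite (derive1_is_derive (fun s => is_derive_pow_davg k v' s cf)).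
by rewrite exprS; field.
Qed.

End Regularity.

(** * The inverse of the cubed radial Laplacian *)

Section Kernel.
Context {R : realType}.
Implicit Types (f g : R -> R) (w : {poly R}) (s t x : R) (n k : nat).

Definition ker (c : R) k : {poly R} := c *: ('X * (1 - 'X) ^+ k).

Lemma ker_horner c k t : (ker c k).[t] = c * (t * (1 - t) ^+ k).
Proof. by rewrite /ker hornerZ hornerM hornerX horner_exp hornerD hornerN hornerX hornerC. Qed.

Lemma euler_weight_horner k w t :
  (euler_weight k w).[t] = k%:R * w.[t] - 2^-1 * (w.[t] + t * (w^`()%R).[t]).
Proof.
rewrite /euler_weight derivM derivX hornerD hornerN !hornerZ hornerD !hornerM hornerX hornerC.
by rewrite mul1r.
Qed.

Lemma deriv_euler_weight k w :
  (euler_weight k w)^`()%R = k%:R *: w^`()%R - 2^-1 *: (2 *: w^`()%R + 'X * w^`(2)%R).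
Proof.
rewrite /euler_weight derivB !derivZ derivM derivX mul1r derivD derivM derivX mul1r.
by rewrite addrA -mulr2n -[_^`()%R *+ 2]scaler_nat derivSn derivn1.
Qed.

Lemma deriv_ker c k : (ker c k.+1)^`()%R =
  c *: ((1 - 'X) ^+ k.+1 - k.+1%:R *: ('X * (1 - 'X) ^+ k)).
Proof.
rewrite /ker derivZ derivM derivX mul1r deriv_exp derivB derivX derivC sub0r.
by rewrite scaler_nat /=; congr (_ *: _); ring.
Qed.


(** The weights [t (1 - t)^k / k!] for k = 5, 3, 1: a power of the Laplacian with exponent 3, 2, 1
    undoes six, four, two integrations. *)
Local Notation kw3 := (ker 120^-1 5).
Local Notation kw2 := (ker 6^-1 3).
Local Notation kw1 := (ker 1 1).

Lemma deriv2_ker c k : (ker c k.+2)^`(2)%R =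
  c *: (- (2 * k.+2)%:R *: (1 - 'X) ^+ k.+1 + (k.+2 * k.+1)%:R *: ('X * (1 - 'X) ^+ k)).
Proof.
rewrite derivSn deriv_ker derivn1 derivZ derivB derivZ deriv_exp derivM derivX mul1r deriv_exp.
rewrite derivB derivX derivC sub0r !scaler_nat scaleNr !scaler_nat /=.
by congr (_ *: _); ring.
Qed.

Lemma deriv2_ker1 c : (ker c 1)^`(2)%R = (- 2 * c)%:P.
Proof.
rewrite derivSn deriv_ker derivn1 expr1 expr0 mulr1 scale1r derivZ !derivB derivX derivC sub0r.
by rewrite -mul_polyC polyCM polyCN; ring.
Qed.

Definition inv_lap3 f s := s ^+ 3 * davg kw3 f s.

Lemma diffn_inv_lap3 n f : diffn n f -> diffn n (inv_lap3 f).
Proof. by move=> cf; apply: diffnM; [apply/diffnX/diffn_id|exact: diffn_davg]. Qed.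

Definition inv_lap3_weight := euler_weight 3 kw3.

Lemma is_derive_inv_lap3 f s : diffn 1 f -> is_derive s (1:R) (inv_lap3 f) (s ^+ 2 * davg inv_lap3_weight f s).
Proof. by move=> cf; apply: is_derive_pow_davg0 => //; rewrite ker_horner; ring. Qed.

(** Each Laplacian removes one power of [s] and moves [kw3] to [kw2], [kw2] to [kw1], [kw1] to 0.
    The boundary terms [e32] and [e21] vanish because 1 is a multiple root of [kw3] and [kw2]; at
    the simple root of [kw1] the value is 1/2, so that exactly [f] survives. *)
Lemma radial_laplacian3_inv f : diffn 1 f ->
  radial_laplacian (radial_laplacian (radial_laplacian (inv_lap3 f))) = f.
Proof.
move=> cf.
rewrite /inv_lap3 (@radial_laplacian_pow_davg _ 2 kw3 kw2 f cf); last 2 first.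
- by rewrite ker_horner; ring.
- move=> t; rewrite !euler_weight_horner !ker_horner deriv_euler_weight deriv_ker deriv2_ker.
  by rewrite !(hornerD, hornerN, hornerZ, hornerM, hornerX, horner_exp, hornerC); field.
have e32 : (euler_weight 3 kw3).[1] = 0.
  rewrite euler_weight_horner !ker_horner deriv_ker.
  by rewrite !(hornerD, hornerN, hornerZ, hornerM, hornerX, horner_exp, hornerC); ring.
under eq_fun do rewrite e32 mulr0 mul0r addr0.
rewrite (@radial_laplacian_pow_davg _ 1 kw2 kw1 f cf); last 2 first.
- by rewrite ker_horner; ring.
- move=> t; rewrite !euler_weight_horner !ker_horner deriv_euler_weight deriv_ker deriv2_ker.
  by rewrite !(hornerD, hornerN, hornerZ, hornerM, hornerX, horner_exp, hornerC); field.
have e21 : (euler_weight 2 kw2).[1] = 0.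
  rewrite euler_weight_horner !ker_horner deriv_ker.
  by rewrite !(hornerD, hornerN, hornerZ, hornerM, hornerX, horner_exp, hornerC); ring.
under eq_fun do rewrite e21 mulr0 mul0r addr0.
rewrite (@radial_laplacian_pow_davg _ 0 kw1 0 f cf); last 2 first.
- by rewrite ker_horner; ring.
- move=> t; rewrite !euler_weight_horner !ker_horner deriv_euler_weight deriv_ker deriv2_ker1.
  by rewrite !(hornerD, hornerN, hornerZ, hornerM, hornerX, horner_exp, hornerC); field.
have e10 : (euler_weight 1 kw1).[1] = 2^-1.
  rewrite euler_weight_horner !ker_horner deriv_ker.
  by rewrite !(hornerD, hornerN, hornerZ, hornerM, hornerX, horner_exp, hornerC); field.
apply/funext => s; rewrite e10 expr0 mul1r divff ?mul1r //.
have -> : davg 0 f s = 0.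
  rewrite /davg -[RHS](int01_cst 0); apply: eq_int01 => t _; by rewrite horner0 mul0r.
by rewrite add0r.
Qed.

End Kernel.

(** * Regularity of limits *)

Section Approximation.
Context {R : realType}.
Implicit Types (f g : R -> R) (w : {poly R}) (s t x A e : R) (n k : nat).

Lemma continuous_approx f :
  (forall A e, 0 < e -> exists2 g, continuous g & forall x, `|x| <= A -> `|g x - f x| <= e) ->
  continuous f.
Proof.
move=> h s; apply/cvgrPdist_lt => e e0.
have e4 : 0 < e / 4 by lra.
have [g cg hg] := h (`|s| + 1) _ e4.
have /cvgrPdist_lt/(_ _ e4) cs := cg s.
near=> t.
have ts : `|t| <= `|s| + 1.
  have -> : t = s + (t - s) by ring.
  rewrite (le_trans (ler_normD _ _)) // lerD2l.
  by apply: ltW; rewrite distrC; near: t; exact: (cvgr_dist_lt (fun x => x)).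
have h1 : `|g s - g t| < e / 4 by near: t.
have h2 := hg t ts.
have h3 : `|g s - f s| <= e / 4 by apply: hg; lra.
move: h1 h2 h3; rewrite !ltr_norml !ler_norml => /andP[? ?] /andP[? ?] /andP[? ?].
by apply/andP; split; lra.
Unshelve. all: by end_near. Qed.

(** Nothing is known beforehand about difference quotients of [f], so the mean value theorem is
    applied to an approximant [g], and the errors in [g] and [g'] are then made arbitrarily
    small. *)
Lemma is_derive_approx f f' : continuous f' ->
  (forall A e, 0 < e -> exists g, exists2 g', forall x, is_derive x (1:R) g (g' x) &
    forall x, `|x| <= A -> `|g x - f x| <= e /\ `|g' x - f' x| <= e) ->
  forall s, is_derive s (1:R) f (f' s).
Proof.
move=> cf' h s.
have bound (d e : R) x : 0 < e -> `|x - s| <= d -> d <= 1 ->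
    (forall y, `|y - s| <= d -> `|f' y - f' s| <= e) ->
    `|f x - f s - (x - s) * f' s| <= e * `|x - s|.
  move=> e0 xs d1 osc; apply/ler_addgt0Pr => e1 e10.
  (* The approximation error is paid twice for values (at [x] and [s]) and [|x - s|] times for the
     derivative, in total [e1]. *)
  have [g [g' dg hg]] := h (`|s| + 1) (e1 / (2 + `|x - s|)) (divr_gt0 e10 (ltr_pwDl (ltr0n _ 2) (normr_ge0 _))).
  have near_s y : `|y - s| <= d -> `|y| <= `|s| + 1.
    move=> ys; have -> : y = s + (y - s) by ring.
    by rewrite (le_trans (ler_normD _ _)) // lerD2l; lra.
  have cg : continuous g by apply: derivable_continuous => y; exact: ex_derive.
  have [c cs ->] : exists2 c, `|c - s| <= d &
      f x - f s - (x - s) * f' s = (f x - g x) - (f s - g s) + (g' c - f' c) * (x - s) + (f' c - f' s) * (x - s).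
    have [sx|xs'] := leP s x.
      have [c] := MVT_segment sx (fun y _ => dg y) (continuous_subspaceT cg).
      rewrite in_itv /= => /andP[c1 c2] e2; exists c.
        by move: xs; rewrite !ger0_norm ?subr_ge0 // => xs; lra.
      have -> : g x = g s + g' c * (x - s) by rewrite -e2; ring.
      ring.
    have [c] := MVT_segment (ltW xs') (fun y _ => dg y) (continuous_subspaceT cg).
    rewrite in_itv /= => /andP[c1 c2] e2; exists c.
      by move: xs; rewrite !ler0_norm ?subr_le0 ?(ltW xs') // => xs; lra.
    have -> : g s = g x + g' c * (s - x) by rewrite -e2; ring.
    ring.
  set D := e1 / _ in hg.
  have ss : `|s - s| <= d by rewrite subrr normr0 (le_trans _ xs).
  have [gx _] := hg x (near_s x xs); have [gs _] := hg s (near_s s ss).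
  have [_ gc] := hg c (near_s c cs).
  rewrite (le_trans (ler_normD _ _)) // addrC lerD //.
    by rewrite normrM ler_wpM2r //; exact: osc.
  have -> : e1 = D * 2 + D * `|x - s|.
    by rewrite -mulrDr /D mulfVK // lt0r_neq0 // ltr_pwDl.
  rewrite (le_trans (ler_normD _ _)) // lerD //; last by rewrite normrM ler_wpM2r.
  rewrite (le_trans (ler_normB _ _)) // mulr_natr mulr2n lerD //; by rewrite distrC.
have c : (h^-1 *: (f (h *: 1 + s) - f s) @[h --> (0:R)^'] --> f' s)%classic.
  apply/cvgrPdist_le => e e0.
  have /cvgrPdist_le/(_ _ e0) [d0 /= d00 osc0] := cf' s.
  (* Halving puts the closed ball of radius [d] inside the open one of radius [d0]; the cap 1 keeps
     it where the approximation holds. *)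
  pose d := Num.min (d0 / 2) 1.
  have dp : 0 < d by rewrite lt_min ltr01 divr_gt0.
  near=> y.
  have y0 : y != 0 by near: y; exact: nbhs_dnbhs_neq.
  have yd : `|y| <= d.
    by near: y; exact: (dnbhs0_le dp).
  have := @bound d e (y + s) e0.
  rewrite addrK => /(_ yd); rewrite ge_min lexx orbT => /(_ isT).
  have -> : y *: (1:R) + s = y + s by rewrite /GRing.scale /= mulr1.
  move=> hb; have {hb} : `|f (y + s) - f s - y * f' s| <= e * `|y|.
    apply: hb => z zs; rewrite distrC; apply: osc0; rewrite /ball_ /= distrC.
    by rewrite (le_lt_trans zs) // /d gt_min ltr_pdivrMr // ltr_pMr // ltr1n.
  have -> : f' s - y^-1 *: (f (y + s) - f s) = - (y^-1 * (f (y + s) - f s - y * f' s)).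
    by rewrite /GRing.scale /=; field.
  by rewrite normrN normrM normfV ler_pdivrMl ?normr_gt0 // [leRHS]mulrC.
apply: DeriveDef; first exact: (cvgP _ c).
exact: cvg_lim c.
Unshelve. all: by end_near. Qed.

Lemma davg_dist w : exists2 C, 0 <= C & forall f g e s, continuous f -> continuous g ->
  (forall x, `|f x - g x| <= e) -> `|davg w f s - davg w g s| <= C * e.
Proof.
have [C C0 hC] := @continuous_bounded R (horner w) 1 (@continuous_horner _ w).
exists C => // f g e s cf cg fg.
have c1 := continuous_horner_scale2 (w := w) (s := s) cf.
have c2 := continuous_horner_scale2 (w := w) (s := s) cg.
have c3 := @diffnB R 0 _ _ c1 c2.
rewrite /davg -(int01B c1 c2) (le_trans (norm_int01_le c3)) //.
rewrite -[leRHS]int01_cst; apply: le_int01; [exact: continuous_norm_comp|exact: cst_continuous|].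
move=> t /andP[t0 t1]; rewrite -mulrBr normrM ler_pM //.
by apply: hC; rewrite ger0_norm.
Qed.

(** The formula for the derivative of [inv_lap3 f] contains no derivative of [f], so it survives
    uniform limits of C^1 functions. *)
Lemma is_derive_inv_lap3_approx f : continuous f ->
  (forall e, 0 < e -> exists2 g, diffn 1 g & forall x, `|g x - f x| <= e) ->
  forall s, is_derive s (1:R) (inv_lap3 f) (s ^+ 2 * davg inv_lap3_weight f s).
Proof.
move=> cf h; apply: is_derive_approx.
  by apply: (@diffnM _ 0); [apply/diffnX/diffn_id|exact: continuous_davg].
move=> A e e0.
have [C3 C30 h3] := davg_dist (ker 120^-1 5); have [Cd Cd0 hd] := davg_dist inv_lap3_weight.
(* [D] dominates the factors by which a uniform error in [f] is amplified in [inv_lap3 f] and in its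
   derivative when [|x| <= |A|]; the 1 makes it positive. *)
pose D := 1 + `|A| ^+ 3 * C3 + `|A| ^+ 2 * Cd.
have A2 : 0 <= `|A| ^+ 2 * Cd by rewrite mulr_ge0 ?exprn_ge0.
have A3 : 0 <= `|A| ^+ 3 * C3 by rewrite mulr_ge0 ?exprn_ge0.
have D0 : 0 < D by rewrite /D; lra.
have [g cg gf] := h (e / D) (divr_gt0 e0 D0).
have c0 := diffn_continuous cg.
exists (inv_lap3 g), (fun s => s ^+ 2 * davg inv_lap3_weight g s); first by move=> x; exact: is_derive_inv_lap3.
have eD : e = e / D * D by rewrite mulfVK // gt_eqF.
have eD0 : 0 < e / D by exact: divr_gt0.
move=> x xA; have xA' : `|x| <= `|A| by rewrite (le_trans xA) // ler_norm.
have xp n : `|x| ^+ n <= `|A| ^+ n by rewrite lerXn2r // nnegrE.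
have x0 n : 0 <= `|x| ^+ n by exact: exprn_ge0.
split.
  rewrite /inv_lap3 -mulrBr normrM normrX.
  rewrite (le_trans (ler_pM (x0 3) (normr_ge0 _) (xp 3) (h3 _ _ _ x c0 cf gf))) //.
  by rewrite mulrA [leRHS]eD [leRHS]mulrC ler_wpM2r ?(ltW eD0) // /D; lra.
rewrite -mulrBr normrM normrX.
rewrite (le_trans (ler_pM (x0 2) (normr_ge0 _) (xp 2) (hd _ _ _ x c0 cf gf))) //.
by rewrite mulrA [leRHS]eD [leRHS]mulrC ler_wpM2r ?(ltW eD0) // /D; lra.
Qed.

Lemma half_pow_small (c e : R) : 0 <= c -> 0 < e -> exists n, c / 2 ^+ n <= e.
Proof.
move=> c0 e0; have [n hn] : exists n, c / e <= n%:R.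
  by exists (Num.bound (c / e)); apply/ltW; exact: archi_boundP (divr_ge0 c0 (ltW e0)).
exists n; rewrite ler_pdivrMr ?exprn_gt0 // mulrC -ler_pdivrMr //.
by rewrite (le_trans hn) // -natrX ler_nat ltnW // ltn_expl.
Qed.

Lemma half_pow_le0 (x c : R) : 0 <= c -> (forall n, x <= c / 2 ^+ n) -> x <= 0.
Proof.
move=> c0 h; apply/ler_addgt0Pr => e e0; have [n hn] := half_pow_small c0 e0.
by rewrite add0r (le_trans (h n)).
Qed.

(** The tail of the geometric series from [n] on is [2 c / 2^n], so the intervals of that radius
    around [u n] are nested; the limit is the supremum of their left ends. *)
Lemma geometric_limit (u : nat -> R) (c : R) :
  (forall n, `|u n.+1 - u n| <= c / 2 ^+ n) ->
  exists l, forall n, `|l - u n| <= 2 * c / 2 ^+ n.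
Proof.
move=> h; pose d n := c / 2 ^+ n.
have dS n : d n.+1 = d n / 2 by rewrite /d exprSr invfM; ring.
have lo n m : (n <= m)%N -> u n - 2 * d n <= u m - 2 * d m.
  elim: m => [|m IH]; first by rewrite leqn0 => /eqP ->.
  rewrite leq_eqVlt => /predU1P[->//|/IH nm]; apply: (le_trans nm).
  by have := h m; rewrite ler_norml dS -/(d m) => /andP[? ?]; lra.
have up n m : (n <= m)%N -> u m + 2 * d m <= u n + 2 * d n.
  elim: m => [|m IH]; first by rewrite leqn0 => /eqP ->.
  rewrite leq_eqVlt => /predU1P[->//|/IH nm]; apply: le_trans nm.
  by have := h m; rewrite ler_norml dS -/(d m) => /andP[? ?]; lra.
have d0 n : 0 <= d n by exact: le_trans (normr_ge0 _) (h n).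
pose X : set R := range (fun n => u n - 2 * d n).
have ub n : ubound X (u n + 2 * d n).
  move=> _ [m _ <-]; have dm := d0 m; have dn := d0 n.
  have [nm|/ltnW mn] := leqP n m.
    by have := up n m nm; lra.
  by have := lo m n mn; lra.
exists (sup X) => n; rewrite ler_norml -mulrA -/(d n).
have h1 : u n - 2 * d n <= sup X.
  by apply: ub_le_sup; [exists (u n + 2 * d n); exact: ub|exists n].
have h2 : sup X <= u n + 2 * d n.
  by apply: ge_sup; [exists (u 0%N - 2 * d 0%N), 0%N|exact: ub].
by apply/andP; split; lra.
Qed.

End Approximation.

(** * The fixed point equation *)

Section FixedPoint.
Context {R : realType}.
Implicit Types (f g u v : R -> R) (s t x : R) (n k : nat).

Lemma davg_ker_le c k f g s : 0 <= c -> continuous f -> continuous g ->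
  (forall t, 0 <= t <= 1 -> f (s * t ^+ 2) <= g (s * t ^+ 2)) ->
  davg (ker c k) f s <= davg (ker c k) g s.
Proof.
move=> c0 cf cg fg; apply: le_int01; [exact: continuous_horner_scale2..|].
move=> t t01; have /andP[t0 t1] := t01; apply: ler_wpM2l; last exact: fg.
by rewrite ker_horner !mulr_ge0 ?exprn_ge0 // subr_ge0.
Qed.

Lemma inv_lap3B f g s : continuous f -> continuous g -> inv_lap3 (fun x => f x - g x) s = inv_lap3 f s - inv_lap3 g s.
Proof.
move=> cf cg; rewrite /inv_lap3 -mulrBr; congr (_ * _); rewrite /davg -int01B; try exact: continuous_horner_scale2.
by apply: eq_int01 => t _; rewrite mulrBr.
Qed.

(** The kernel is nonnegative on [[0, 1]], so pointwise bounds pass through the average. The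
    absolute value on the right accounts for [s ^+ 3] being negative when [s < 0]. *)
Lemma norm_inv_lap3_le f phi (a : R) s : 0 <= a -> continuous f -> continuous phi ->
  (forall x, `|f x| <= a * phi x) -> `|inv_lap3 f s| <= a * `|inv_lap3 phi s|.
Proof.
move=> a0 cf cp fp; rewrite /inv_lap3 !normrM [leRHS]mulrCA ler_wpM2l //.
have Ma b : davg (ker 120^-1 5) (fun x => b * phi x) s = b * davg (ker 120^-1 5) phi s.
  rewrite /davg -int01Z; last exact: continuous_horner_scale2.
  by apply: eq_int01 => t _; ring.
have cM b : continuous (fun x => b * phi x) := @diffnZ R 0 b phi cp.
have c0 : 0 <= (120^-1 : R) by rewrite invr_ge0.
have aM : `|a * davg (ker 120^-1 5) phi s| = a * `|davg (ker 120^-1 5) phi s|.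
  by rewrite normrM ger0_norm.
rewrite -aM ler_norml; apply/andP; split.
  have lo : - a * davg (ker 120^-1 5) phi s <= davg (ker 120^-1 5) f s.
    rewrite -Ma; apply: davg_ker_le => // t _; have := fp (s * t ^+ 2).
    by rewrite ler_norml mulNr => /andP[].
  by rewrite (le_trans _ lo) // mulNr lerN2 ler_norm.
have up : davg (ker 120^-1 5) f s <= a * davg (ker 120^-1 5) phi s.
  rewrite -Ma; apply: davg_ker_le => // t _; have := fp (s * t ^+ 2).
  by rewrite ler_norml => /andP[].
by rewrite (le_trans up) // ler_norm.
Qed.

Definition icube u x : R := (u x ^+ 3)^-1.

(** The difference factors as [b - a] times three monomials of degree 4 in the inverses of [a] and
    [b], each at most [(2 / p)^4]; hence 48 = 3 * 16. *)
Lemma icube_dist (p a b c : R) : 0 < p -> p / 2 <= a -> p / 2 <= b -> `|a - b| <= c * p ->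
  `|(a ^+ 3)^-1 - (b ^+ 3)^-1| <= 48 * c * (p ^+ 3)^-1.
Proof.
move=> p0 pa pb ab.
have a0 : 0 < a by lra.
have b0 : 0 < b by lra.
have h (y : R) : p / 2 <= y -> 0 < y -> 0 <= y^-1 <= 2 / p.
  by move=> py y0; rewrite invr_ge0 ltW //= -[2 / p]invf_div lef_pV2 // posrE divr_gt0.
have /andP[x0 x2] := h a pa a0; have /andP[y0 y2] := h b pb b0.
have -> : (a ^+ 3)^-1 - (b ^+ 3)^-1 =
    (b - a) * (a^-1 * (b^-1) ^+ 3 + (a^-1) ^+ 2 * (b^-1) ^+ 2 + (a^-1) ^+ 3 * b^-1).
  by field; rewrite !gt_eqF.
have q0 : 0 <= 2 / p by rewrite divr_ge0 // ltW.
have e n (z : R) : 0 <= z -> z <= 2 / p -> z ^+ n <= (2 / p) ^+ n.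
  by move=> z0 z2; rewrite lerXn2r // nnegrE.
have -> : 48 * c * (p ^+ 3)^-1 = (c * p) * ((2 / p) * (2 / p) ^+ 3 + (2 / p) ^+ 2 * (2 / p) ^+ 2 + (2 / p) ^+ 3 * (2 / p)).
  by field; rewrite gt_eqF.
rewrite normrM distrC ler_pM //.
rewrite ger0_norm; last by rewrite !addr_ge0 // mulr_ge0 // ?exprn_ge0.
by rewrite !lerD // ler_pM // ?exprn_ge0 // e.
Qed.


Lemma diffn_icube n u : (forall x, u x != 0) -> diffn n u -> diffn n (icube u).
Proof. by move=> u0 cu; apply: diffnV; [move=> x; rewrite expf_neq0|exact: diffnX]. Qed.

Section Iteration.
Variables (P : R -> R) (m B : R).
Hypotheses (P_smooth : forall n, diffn n P) (m_gt0 : 0 < m) (P_ge : forall s, m <= P s).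
Hypotheses (B_ge0 : 0 <= B) (KP : forall s, `|inv_lap3 (icube P) s| <= B * P s).

Let P_gt0 s : 0 < P s. Proof. exact: lt_le_trans (P_ge s). Qed.

Definition picard (d : R) u s := P s - d * inv_lap3 (icube u) s.

(** The lower bound is what keeps [icube u] below [8 * icube P]; the Picard map preserves this
    set. *)
Definition large u := continuous u /\ forall s, P s / 2 <= u s.

Lemma large_gt0 u s : large u -> 0 < u s.
Proof. by move=> [_ h]; apply: lt_le_trans (h s); rewrite divr_gt0. Qed.

Lemma large_icube u : large u -> continuous (icube u).
Proof.
move=> lu; apply: (@diffn_icube 0); last by case: lu.
by move=> x; rewrite gt_eqF // large_gt0.
Qed.

Lemma large_P : large P.
Proof. by split; [exact: (P_smooth 0)|move=> s; have := P_gt0 s; lra]. Qed.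

Lemma inv_lap3_icube_dist (c : R) u v s : 0 <= c -> large u -> large v ->
  (forall x, `|u x - v x| <= c * P x) ->
  `|inv_lap3 (icube u) s - inv_lap3 (icube v) s| <= 48 * c * (B * P s).
Proof.
move=> c0 lu lv uv; have cu := large_icube lu; have cv := large_icube lv.
rewrite -inv_lap3B //; have c48 : 0 <= 48 * c by rewrite mulr_ge0.
apply: (le_trans (norm_inv_lap3_le (phi := icube P) s c48 _ (large_icube large_P) _)).
- exact: (@diffnB R 0).
- by move=> x; apply: icube_dist => //; [case: lu => _; exact|case: lv => _; exact].
- by rewrite ler_wpM2l.
Qed.

Lemma inv_lap3_icube_le u s : large u -> `|inv_lap3 (icube u) s| <= 8 * (B * P s).
Proof.
move=> lu; apply: (le_trans (norm_inv_lap3_le (phi := icube P) (a := 8) s _ (large_icube lu) (large_icube large_P) _)) => //.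
- move=> x; have u0 := large_gt0 x lu; have Px := P_gt0 x.
  have P2 : 0 < P x / 2 by rewrite divr_gt0.
  rewrite /icube ger0_norm; last by rewrite invr_ge0 exprn_ge0 // ltW.
  have -> : 8 * (P x ^+ 3)^-1 = ((P x / 2) ^+ 3)^-1 by field; rewrite gt_eqF.
  rewrite lef_pV2 ?posrE ?exprn_gt0 //.
  by apply: lerXn2r; rewrite ?nnegrE; [exact: ltW|exact: ltW|case: lu => _; exact].
- by rewrite ler_wpM2l.
Qed.

Lemma picard_continuous d u : large u -> continuous (picard d u).
Proof.
move=> lu; apply: (@diffnB R 0); first exact: (P_smooth 0).
by apply: (@diffnZ R 0); apply: (@diffn_inv_lap3 R 0); exact: large_icube.
Qed.

Section FixedParameter.
Variable d : R.
(** With 96 = 2 * 48 the contraction factor [48 d B] is at most 1/2, and one step moves away from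
    [P] by at most [8 d B P <= P / 12]. *)
Hypotheses (d_ge0 : 0 <= d) (dB : d * B <= 96^-1).

Let dBP (c : R) s : 0 <= c -> d * (c * (B * P s)) <= c / 96 * P s.
Proof.
move=> c0; have -> : d * (c * (B * P s)) = (c * P s) * (d * B) by ring.
have -> : c / 96 * P s = (c * P s) * 96^-1 by ring.
by rewrite ler_wpM2l // mulr_ge0 // ltW.
Qed.

Lemma picard_near u s : large u -> `|picard d u s - P s| <= P s / 12.
Proof.
move=> lu; rewrite /picard addrAC subrr add0r normrN normrM ger0_norm //.
apply: (le_trans (ler_wpM2l d_ge0 (inv_lap3_icube_le s lu))).
by apply: (le_trans (dBP s _)) => //; have := P_gt0 s; lra.
Qed.

Lemma picard_large u : large u -> large (picard d u).
Proof.
move=> lu; split; first exact: picard_continuous.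
by move=> s; have := picard_near s lu; have := P_gt0 s; rewrite ler_norml => ? /andP[]; lra.
Qed.

Lemma picard_contraction (c : R) u v s : 0 <= c -> large u -> large v ->
  (forall x, `|u x - v x| <= c * P x) -> `|picard d u s - picard d v s| <= c / 2 * P s.
Proof.
move=> c0 lu lv uv; have -> : picard d u s - picard d v s = - (d * (inv_lap3 (icube u) s - inv_lap3 (icube v) s)).
  by rewrite /picard; ring.
rewrite normrN normrM ger0_norm //.
apply: (le_trans (ler_wpM2l d_ge0 (inv_lap3_icube_dist s c0 lu lv uv))).
apply: (le_trans (dBP s _)); first by rewrite mulr_ge0.
by have -> : 48 * c / 96 = c / 2 by field.
Qed.

Lemma picard_smooth n u : (forall x, u x != 0) -> diffn n u -> diffn n (picard d u).
Proof.
move=> u0 cu; apply: diffnB; first exact: P_smooth.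
by apply/diffnZ/diffn_inv_lap3/diffn_icube.
Qed.

(* [inv_lap3] gains a derivative, but [is_derive_inv_lap3] needs a C^1 argument; the first step of
   the bootstrap therefore goes through smooth approximations of [u] (the Picard iterates). *)
Lemma fixed_point_smooth u : large u -> u =1 picard d u ->
  (forall e, 0 < e -> exists2 v, large v /\ diffn 1 v & forall x, `|v x - u x| <= e * P x) ->
  forall n, diffn n u.
Proof.
move=> lu uT happ.
have u0 x : u x != 0 by rewrite gt_eqF // large_gt0.
have dK s : is_derive s (1:R) (inv_lap3 (icube u)) (s ^+ 2 * davg inv_lap3_weight (icube u) s).
  apply: is_derive_inv_lap3_approx; first exact: large_icube.
  (* By [icube_dist] a relative error [c] in [u] yields at most [48 c / P^3 <= 48 c / m^3] in
     [icube u]. *)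
  move=> e e0; have e' : 0 < e * (m ^+ 3) / 48 by rewrite divr_gt0 // mulr_gt0 // exprn_gt0.
  have [v [lv cv] vu] := happ _ e'.
  exists (icube v); first by apply: diffn_icube => // x; rewrite gt_eqF // large_gt0.
  move=> x; apply: (le_trans (icube_dist (P_gt0 x) _ _ (vu x))).
  - by case: lv.
  - by case: lu.
  - have -> : 48 * (e * m ^+ 3 / 48) = e * m ^+ 3 by field.
    rewrite ler_pdivrMr; last exact: exprn_gt0.
    rewrite ler_wpM2l; [by []|exact: ltW|].
    by apply: lerXn2r; rewrite ?nnegrE; [exact: ltW|exact: ltW|exact: P_ge].
(* In [dK] the derivative of [inv_lap3 (icube u)] is an average of [icube u], hence as regular as
   [u]; the fixed point equation then gains one derivative. *)
have du n : diffn n u -> diffn n.+1 u.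
  move=> cu; have ci := diffn_icube u0 cu.
  apply: (eq_diffn (f := picard d u)); first by move=> x; rewrite -uT.
  apply: diffnB; first exact: P_smooth.
  apply: diffnZ; apply: (diffn_derive dK); apply: diffnM; first exact/diffnX/diffn_id.
  exact: diffn_davg.
elim=> [|n IH]; last exact: du.
by case: lu.
Qed.

Lemma fixed_point_exists : exists u, [/\ (forall n, diffn n u),
  (forall s, `|u s - P s| <= P s / 2) & u =1 picard d u].
Proof.
pose U n := iter n (picard d) P.
have lU n : large (U n) by elim: n => [|n IH]; [exact: large_P|exact: picard_large].
have stepU n s : `|U n.+1 s - U n s| <= P s / 2 ^+ n.
  elim: n s => [|n IH] s.
    rewrite expr0 divr1; apply: (le_trans (picard_near s large_P)).
    by have := P_gt0 s; lra.
  have c0 : 0 <= (2 ^+ n)^-1 :> R by rewrite invr_ge0 exprn_ge0.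
  have /= := picard_contraction s c0 (lU n.+1) (lU n) _.
  rewrite exprSr invfM mulrC; apply => x.
  by rewrite mulrC; exact: IH.
(* The limit is taken point by point. The error is a multiple of [P s] by a constant independent of
   [s], which is convergence in the weighted norm. *)
have [u uU0] := boolp.choice (fun s => geometric_limit (stepU ^~ s)).
have uU n s : `|u s - U n s| <= 2 * P s / 2 ^+ n by exact: uU0.
have uU' n s : `|u s - U n s| <= 2 / 2 ^+ n * P s.
  by rewrite mulrAC; exact: uU.
have UX n : diffn 1 (U n).
  elim: n => [|n IH]; first exact: P_smooth.
  by apply: picard_smooth => // x; rewrite gt_eqF // (large_gt0 _ (lU n)).
have nearP s n : `|U n s - P s| <= P s / 12.
  case: n => [|n]; last exact: picard_near.
  by rewrite /U /= subrr normr0; have := P_gt0 s; lra.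
have uP s : `|u s - P s| <= P s / 2.
  have [n hn] := half_pow_small (c := 2 * P s) (e := P s / 12) ltac:(have := P_gt0 s; lra) ltac:(have := P_gt0 s; lra).
  have -> : u s - P s = (u s - U n s) + (U n s - P s) by ring.
  apply: (le_trans (ler_normD _ _)).
  by have := uU n s; have := nearP s n; have := P_gt0 s; lra.
have lu : large u.
  split; last first.
    by move=> s; have := uP s; have := P_gt0 s; rewrite ler_norml => ? /andP[]; lra.
  apply: continuous_approx => A e e0.
  have [C C0 hC] := @continuous_bounded R P A (P_smooth 0).
  have [n hn] := half_pow_small (c := 2 * C) (mulr_ge0 (ler0n _ 2) C0) e0.
  exists (U n); first by case: (lU n).
  move=> x xA; rewrite distrC (le_trans (uU n x)) // (le_trans _ hn) //.
  rewrite ler_wpM2r ?invr_ge0 ?exprn_ge0 // ler_wpM2l //.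
  by rewrite (le_trans (ler_norm _)) // hC.
have uT : u =1 picard d u.
  move=> s; apply/eqP; rewrite -subr_eq0 -normr_le0.
  apply: (@half_pow_le0 _ _ (2 * P s)); first by rewrite mulr_ge0 // ltW.
  (* [U n.+1] is [picard d (U n)], so both brackets are at most half of [2 P s / 2^n]. *)
  move=> n; have -> : u s - picard d u s = (u s - U n.+1 s) - (picard d u s - picard d (U n) s) by rewrite /U /=; ring.
  apply: (le_trans (ler_normB _ _)).
  have c0 : 0 <= 2 / 2 ^+ n :> R by rewrite divr_ge0 // exprn_ge0.
  have h1 := picard_contraction s c0 lu (lU n) (uU' n).
  have h2 := uU' n.+1 s; rewrite exprS in h2.
  have e2 : 2 / (2 * 2 ^+ n) = 2 / 2 ^+ n / 2 :> R by rewrite invfM; ring.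
  rewrite e2 in h2; have -> : 2 * P s / 2 ^+ n = 2 / 2 ^+ n * P s by ring.
  have -> : 2 / 2 ^+ n * P s = 2 / 2 ^+ n / 2 * P s + 2 / 2 ^+ n / 2 * P s by field; rewrite expf_neq0.
  exact: lerD.
exists u; split => //; apply: fixed_point_smooth => // e e0.
have [n hn] := half_pow_small (c := 2) (ler0n _ 2) e0.
exists (U n) => // x; rewrite distrC (le_trans (uU' n x)) // ler_wpM2r // ltW //.
Qed.

End FixedParameter.

(** A relative distance [q] between [u] and [v] improves to [q / 2 + 8 B |d - d'|], whose fixed
    value is [16 B |d - d'|]. Iterating from [q = 1], given by closeness to [P], avoids a
    supremum. *)
Lemma fixed_point_lipschitz (d d' : R) u v : 0 <= d -> d * B <= 96^-1 ->
  (forall s, `|u s - P s| <= P s / 2) -> (forall s, `|v s - P s| <= P s / 2) ->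
  continuous u -> continuous v -> u =1 picard d u -> v =1 picard d' v ->
  forall s, `|u s - v s| <= 16 * B * `|d - d'| * P s.
Proof.
move=> d0 dB uP vP cu cv uT vT.
have lu : large u.
  by split=> // s; have := uP s; rewrite ler_norml => /andP[]; lra.
have lv : large v.
  by split=> // s; have := vP s; rewrite ler_norml => /andP[]; lra.
have B0 : 0 <= 16 * B * `|d - d'| by rewrite !mulr_ge0.
have h n s : `|u s - v s| <= ((2 ^+ n)^-1 + 16 * B * `|d - d'|) * P s.
  elim: n s => [|n IH] s.
    have -> : u s - v s = (u s - P s) - (v s - P s) by ring.
    apply: (le_trans (ler_normB _ _)); rewrite expr0 invr1 mulrDl mul1r.
    have := mulr_ge0 B0 (ltW (P_gt0 s)); have := uP s; have := vP s; lra.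
  have c0 : 0 <= (2 ^+ n)^-1 + 16 * B * `|d - d'| by rewrite addr_ge0 // invr_ge0 exprn_ge0.
  have h1 := picard_contraction d0 dB s c0 lu lv IH.
  have -> : u s - v s = (picard d u s - picard d v s) - (d - d') * inv_lap3 (icube v) s.
    by rewrite {1}uT {1}vT /picard; ring.
  apply: (le_trans (ler_normB _ _)).
  have h2 : `|(d - d') * inv_lap3 (icube v) s| <= `|d - d'| * (8 * (B * P s)).
    by rewrite normrM ler_wpM2l // inv_lap3_icube_le.
  apply: (le_trans (lerD h1 h2)).
  have -> : (2 ^+ n.+1)^-1 = (2 ^+ n)^-1 / 2 :> R by rewrite exprSr invfM mulrC.
  by rewrite le_eqVlt; apply/orP; left; apply/eqP; field; rewrite expf_neq0.
move=> s; rewrite -subr_le0; apply: (@half_pow_le0 _ _ (P s)); first exact: ltW.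
move=> n; rewrite lerBlDr (le_trans (h n s)) // mulrDl lerD2r mulrC //.
Qed.

End Iteration.

End FixedPoint.

(** * The nearly vanishing profile *)

Section Profile.
Context {R : realType}.
Implicit Types (f g u : R -> R) (s t x : R) (n k : nat).

Lemma diffn_radial_laplacian n f : diffn n.+2 f -> diffn n (radial_laplacian f).
Proof.
move=> cf; have [_ [_ cf2]] := cf; have [_ /diffnS cf1] := cf.
rewrite /radial_laplacian; apply: diffnD; last exact: diffnZ.
by apply: diffnM => //; exact/diffnZ/diffn_id.
Qed.

Lemma radial_laplacianD (c : R) f g : diffn 2 f -> diffn 2 g ->
  radial_laplacian (fun s => f s + c * g s) =
  fun s => radial_laplacian f s + c * radial_laplacian g s.
Proof.
move=> cf cg.
have lin f1 g1 : diffn 1 f1 -> diffn 1 g1 -> (fun s => f1 s + c * g1 s)^`()%classic =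
    fun s => f1^`()%classic s + c * g1^`()%classic s.
  move=> c1 c2; apply: derive1_is_derive => x.
  by apply: (is_derive_add (diffn_is_derive x c1) (is_derive_scale (k := c) (diffn_is_derive x c2) erefl)).
rewrite /radial_laplacian lin; [|exact: diffnS..].
rewrite lin; [|by case: cf|by case: cg].
have e (s a1 a2 b1 b2 : R) : 4 * s * (a2 + c * b2) + 6 * (a1 + c * b1) =
  4 * s * a2 + 6 * a1 + c * (4 * s * b2 + 6 * b1) by ring.
by apply/funext => s; exact: e.
Qed.

Lemma radial_laplacianZ (c : R) f : diffn 2 f ->
  radial_laplacian (fun s => c * f s) = fun s => c * radial_laplacian f s.
Proof.
move=> cf; have := radial_laplacianD c (diffn_cst 2 (0:R)) cf.
have z : (fun=> 0 : R)^`()%classic = (fun=> 0 : R) by apply: derive1_is_derive => x; exact: is_derive_cst.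
have z2 : radial_laplacian (fun=> 0 : R) = fun=> 0.
  by rewrite /radial_laplacian z z; apply/funext => s; rewrite !mulr0 addr0.
rewrite z2; have -> : (fun s => 0 + c * f s) = fun s => c * f s.
  by apply/funext => s; rewrite add0r.
by move=> ->; apply/funext => s; rewrite add0r.
Qed.

Variable eta : R.
Hypothesis eta_gt0 : 0 < eta.

Definition profile s : R := eta ^+ 2 + (1 - s) ^+ 2.

Lemma profile_ge s : eta ^+ 2 <= profile s.
Proof. by rewrite lerDl sqr_ge0. Qed.

Lemma profile_gt0 s : 0 < profile s.
Proof. by apply: lt_le_trans (profile_ge s); rewrite exprn_gt0. Qed.

Lemma profile_smooth n : diffn n profile.
Proof.
apply: diffnD; first exact: diffn_cst.
by apply/diffnX/diffnB; [exact: diffn_cst|exact: diffn_id].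
Qed.

(** The radial Laplacian lowers the degree in [s] by one: [profile] goes to [20 s - 12], then to
    120, then to 0. *)
Lemma radial_laplacian3_profile :
  radial_laplacian (radial_laplacian (radial_laplacian profile)) = fun=> 0.
Proof.
have aff (a b : R) : (fun s => a * s + b)^`()%classic = fun=> a.
  apply: derive1_is_derive => x.
  apply: (is_derive_add (is_derive_scale (k := a) (is_derive_id x 1) erefl) (is_derive_cst b x 1)).
  by rewrite mulr1 addr0.
have cst (a : R) : (fun=> a : R)^`()%classic = fun=> 0.
  by apply: derive1_is_derive => x; exact: is_derive_cst.
have rl_aff (a b : R) : radial_laplacian (fun s => a * s + b) = fun=> 6 * a.
  by rewrite /radial_laplacian aff cst; apply/funext => s; rewrite mulr0 add0r.
have dp : profile^`()%classic = fun s => 2 * s + (-2).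
  apply: derive1_is_derive => x.
  have d1 : is_derive x (1:R) (fun s => 1 - s) (-1).
    have h := is_derive_add (is_derive_cst (1:R) x 1) (is_derive_scale (k := -1) (is_derive_id x 1) erefl) erefl.
    have -> : (fun s => 1 - s) = (fun s : R => 1 + -1 * s) by apply/funext => y; rewrite mulN1r.
    by rewrite mulr1 add0r in h.
  apply: (is_derive_add (is_derive_cst (eta ^+ 2) x 1) (is_derive_mul d1 d1 erefl)).
  by ring.
have -> : radial_laplacian profile = fun s => 20 * s + (- 12).
  by rewrite /radial_laplacian dp aff; apply/funext => s; ring.
by rewrite rl_aff (_ : (fun=> _) = fun s => 0 * s + 6 * 20) ?rl_aff ?mulr0 //; apply/funext => s; ring.
Qed.

Lemma radial_laplacian3_fixed_point (d : R) u : (forall n, diffn n u) -> (forall s, 0 < u s) ->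
  u =1 picard profile d u ->
  radial_laplacian (radial_laplacian (radial_laplacian u)) = fun s => - d * icube u s.
Proof.
move=> cu u0 uT.
have ci n : diffn n (icube u) by apply: diffn_icube => // x; rewrite gt_eqF.
have cK n := diffn_inv_lap3 (ci n); have cP := profile_smooth.
have e : u = fun s => profile s + (- d) * inv_lap3 (icube u) s.
  by apply/funext => s; rewrite {1}uT /picard mulNr.
have rl f : (forall n, diffn n f) -> forall n, diffn n (radial_laplacian f).
  by move=> cf n; exact/diffn_radial_laplacian/cf.
rewrite [X in radial_laplacian (radial_laplacian (radial_laplacian X))]e.
rewrite (radial_laplacianD _ (cP 2) (cK 2)).
rewrite (radial_laplacianD _ (rl _ cP 2) (rl _ cK 2)).
rewrite (radial_laplacianD _ (rl _ (rl _ cP) 2) (rl _ (rl _ cK) 2)).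
apply: (etrans (congr2 (fun a b : R -> R => fun s => a s + - d * b s)
  radial_laplacian3_profile (radial_laplacian3_inv (ci 1)))).
by apply/funext => s; rewrite add0r.
Qed.

(* The two values [1 - s] and [1 - s t^2] cannot both be small: they differ by [s (1 - t^2)]. *)
Lemma profile_dilation s t : 0 <= t <= 1 ->
  s ^+ 2 * (t * (1 - t) ^+ 5) * icube profile (s * t ^+ 2) <=
  4 / eta ^+ 4 * profile s * (t * (profile (s * t ^+ 2))^-1).
Proof.
move=> /andP[t0 t1]; set y := s * t ^+ 2.
have p0 := profile_gt0 s; have q0 := profile_gt0 y.
have e2 : 0 < eta ^+ 2 by rewrite exprn_gt0.
have key : s ^+ 2 * (1 - t) ^+ 2 <= 2 * (profile s + profile y).
  have h1 : s ^+ 2 * (1 - t) ^+ 2 <= s ^+ 2 * (1 - t) ^+ 2 * (1 + t) ^+ 2.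
    have u1 : 1 <= (1 + t) ^+ 2 by apply: exprn_ege1; lra.
    by rewrite -[leLHS]mulr1 ler_wpM2l // mulr_ge0 ?sqr_ge0.
  apply: (le_trans h1).
  have -> : s ^+ 2 * (1 - t) ^+ 2 * (1 + t) ^+ 2 = ((1 - y) - (1 - s)) ^+ 2 by rewrite /y; ring.
  have := sqr_ge0 ((1 - y) + (1 - s)); have := sqr_ge0 eta.
  rewrite /profile; nra.
(* Two of the five factors [1 - t] compensate [s ^+ 2]; the other three are bounded by 1. *)
have t5 : (1 - t) ^+ 5 <= (1 - t) ^+ 2.
  by apply: ler_wiXn2l => //; lra.
have ic : 0 < icube profile y by rewrite invr_gt0 exprn_gt0.
have pe : eta ^+ 2 <= profile s := profile_ge s.
have qe : eta ^+ 2 <= profile y := profile_ge y.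
have h2 : s ^+ 2 * (t * (1 - t) ^+ 5) <= t * (2 * (profile s + profile y)).
  rewrite mulrCA ler_wpM2l // (le_trans _ key) // ler_wpM2l ?sqr_ge0 //.
apply: (le_trans (ler_wpM2r (ltW ic) h2)).
have -> : 4 / eta ^+ 4 * profile s * (t * (profile y)^-1) =
  t * (4 * profile s * profile y ^+ 2 / eta ^+ 4) * icube profile y.
  by rewrite /icube; field; rewrite !gt_eqF.
rewrite ler_wpM2r ?(ltW ic) // ler_wpM2l // ler_pdivlMr ?exprn_gt0 //.
(* It remains to see that [eta^4 (P(s) + P(y)) <= 2 P(s) P(y)^2], which follows from [P >= eta^2] at
   both points. *)
have -> : eta ^+ 4 = (eta ^+ 2) ^+ 2 by rewrite -exprM.
have a1 : (eta ^+ 2) ^+ 2 <= profile y ^+ 2.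
  by apply: lerXn2r; rewrite ?nnegrE //; exact: ltW.
have a2 : profile y * (eta ^+ 2) ^+ 2 <= profile s * profile y ^+ 2.
  have -> : profile y * (eta ^+ 2) ^+ 2 = eta ^+ 2 * (profile y * eta ^+ 2) by ring.
  rewrite [profile y ^+ 2]expr2; apply: ler_pM => //.
  - exact: ltW.
  - by rewrite mulr_ge0 // ltW.
  - exact: ler_wpM2l (ltW q0) _ _ qe.
have a3 : profile s * (eta ^+ 2) ^+ 2 <= profile s * profile y ^+ 2 by rewrite ler_wpM2l // ltW.
lra.
Qed.

(** [profile_dilation] spends two of the three powers of [s]. The third makes [s t / P(s t^2)]
    integrable in closed form by an arctangent, with value at most [2 / eta]. The constant is
    [(4 / 120) * 2 = 1 / 15]. *)
Lemma inv_lap3_profile_le s : `|inv_lap3 (icube profile) s| <= (eta ^+ 5)^-1 / 15 * profile s.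
Proof.
have ci : continuous (icube profile).
  by apply: (@diffn_icube _ 0); [move=> x; rewrite gt_eqF // profile_gt0|exact: profile_smooth].
have cv : continuous (fun x => (profile x)^-1).
  by apply: (@diffnV _ 0); [move=> x; rewrite gt_eqF // profile_gt0|exact: profile_smooth].
pose A := davg 'X (fun x => (profile x)^-1) s.
have cA := @continuous_horner_scale2 R 'X _ s cv.
have cI := @continuous_horner_scale2 R (ker 120^-1 5) _ s ci.
have M0 : 0 <= davg (ker 120^-1 5) (icube profile) s.
  rewrite -[leLHS](int01_cst 0); apply: le_int01 => //; first exact: cst_continuous.
  move=> t /andP[t0 t1]; rewrite mulr_ge0 ?invr_ge0 ?exprn_ge0 ?(ltW (profile_gt0 _)) //.
  by rewrite ker_horner !mulr_ge0 ?invr_ge0 ?exprn_ge0 // subr_ge0.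
have h1 : s ^+ 2 * davg (ker 120^-1 5) (icube profile) s <= 4 / eta ^+ 4 * profile s / 120 * A.
  rewrite /A /davg -!int01Z //; apply: le_int01; [exact: (@diffnZ _ 0)..|].
  move=> t t01; rewrite ker_horner hornerX; have := profile_dilation s t01; nra.
have h2 : `|s * A| <= 2 / eta.
  (* The total variation of [atan] is [pi <= 4], and [4 / (2 eta) = 2 / eta]. *)
  pose Phi t := (2 * eta)^-1 * atan ((s * t ^+ 2 - 1) / eta).
  have dPhi t : is_derive t (1:R) Phi (s * ('X.[t] * (profile (s * t ^+ 2))^-1)).
    have d1 : is_derive t (1:R) (fun t => t ^+ 2) (2 * t).
      by have := is_derive_pow 2 t.
    have d2 : is_derive t (1:R) (fun t => s * t ^+ 2 - 1) (s * (2 * t)).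
      apply: (is_derive_add (is_derive_scale (k := s) d1 erefl) (is_derive_cst (-1 : R) t 1)).
      by rewrite addr0.
    have d3 : is_derive t (1:R) (fun t => (s * t ^+ 2 - 1) / eta) (s * (2 * t) / eta).
      apply: (is_derive_mul d2 (is_derive_cst eta^-1 t 1)).
      by rewrite mulr0 addr0.
    have d4 := is_derive_compose (g := fun t => (s * t ^+ 2 - 1) / eta) (is_derive1_atan _) d3 erefl.
    apply: (is_derive_scale (k := (2 * eta)^-1) d4).
    rewrite hornerX /profile; set y := s * t ^+ 2.
    have z1 : eta ^+ 2 + (1 - y) ^+ 2 != 0 by rewrite gt_eqF // profile_gt0.
    have z2 : 1 + ((y - 1) / eta) ^+ 2 != 0 by rewrite gt_eqF // ltr_pwDl // sqr_ge0.
    have z3 : eta != 0 by rewrite gt_eqF.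
    have -> : 1 + ((y - 1) / eta) ^+ 2 = (eta ^+ 2 + (1 - y) ^+ 2) / eta ^+ 2 by field.
    by field; rewrite z3 z1.
  have cs : continuous (fun t => s * ('X.[t] * (profile (s * t ^+ 2))^-1)) by exact: (@diffnZ _ 0).
  rewrite /A /davg -(int01Z s cA) (int01_derive cs dPhi) /Phi -mulrBr normrM ger0_norm; last first.
    by rewrite invr_ge0 mulr_ge0 // ltW.
  have -> : 2 / eta = (2 * eta)^-1 * 4 by field; rewrite gt_eqF.
  rewrite ler_wpM2l ?invr_ge0 ?mulr_ge0 ?(ltW eta_gt0) //.
  set a := atan _; set b := atan _.
  have := atan_ltpi2 ((s * 1 ^+ 2 - 1) / eta); have := atan_gtNpi2 ((s * 1 ^+ 2 - 1) / eta).
  have := atan_ltpi2 ((s * 0 ^+ 2 - 1) / eta); have := atan_gtNpi2 ((s * 0 ^+ 2 - 1) / eta).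
  have p4 : (pi : R) <= 4 by have := @pihalf_lt2 R; lra.
  rewrite -/a -/b ler_norml; lra.
rewrite /inv_lap3 normrM normrX [`|s| ^+ 3]exprS -[_ * _ * `|davg _ _ _|]mulrA.
have -> : `|s| ^+ 2 * `|davg (ker 120^-1 5) (icube profile) s| = s ^+ 2 * davg (ker 120^-1 5) (icube profile) s.
  by rewrite real_normK ?num_real // (ger0_norm M0).
apply: (le_trans (ler_wpM2l (normr_ge0 s) h1)).
have A0 : 0 <= A.
  rewrite -[leLHS](int01_cst 0); apply: le_int01 => //; first exact: cst_continuous.
  by move=> t /andP[t0 _]; rewrite hornerX mulr_ge0 // invr_ge0 ltW // profile_gt0.
rewrite normrM (ger0_norm A0) in h2.
have -> : (eta ^+ 5)^-1 / 15 * profile s = (4 / eta ^+ 4 * profile s / 120) * (2 / eta).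
  by field; rewrite gt_eqF.
rewrite mulrCA ler_wpM2l //.
by rewrite !mulr_ge0 ?invr_ge0 ?exprn_ge0 ?(ltW eta_gt0) // ltW // profile_gt0.
Qed.

End Profile.

(** * Radial functions on three-space *)

Section Space.
Local Notation coord := Defs.coord.
Context {R : realType}.
Implicit Types (g : R -> R) (i : 'I_3) (p : R3 R).

(** A class containing [g (sqnorm3 p)], consisting of continuous functions and closed under partial
    derivatives; smoothness follows by induction on the list of derivatives. *)
Inductive radial_algebra g : (R3 R -> R) -> Prop :=
| RA_derive n : radial_algebra g (fun p => (g^`(n))%classic (sqnorm3 p))
| RA_coord i : radial_algebra g (coord i)
| RA_cst (c : R) : radial_algebra g (fun=> c)
| RA_add u v : radial_algebra g u -> radial_algebra g v -> radial_algebra g (fun p => u p + v p)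
| RA_mul u v : radial_algebra g u -> radial_algebra g v -> radial_algebra g (fun p => u p * v p).

Lemma coord_setc i j p t : coord j (setc i p t) = if j == i then t else coord j p.
Proof. by case: i => -[|[|[|]]] // hi; case: j => -[|[|[|]]] // hj; case: p => [[]]. Qed.

Lemma setc_coord i p : setc i p (coord i p) = p.
Proof. by case: i => -[|[|[|]]] // hi; case: p => [[]]. Qed.

Lemma sqnorm3_setc i p t : sqnorm3 (setc i p t) = t ^+ 2 + (sqnorm3 p - coord i p ^+ 2).
Proof. by case: i => -[|[|[|]]] // hi; case: p => [[a b] c]; rewrite /sqnorm3 /setc /coord /=; ring. Qed.

Lemma continuous_coord i : continuous (@coord R i).
Proof.
case: i => -[|[|[|]]] // hi p; rewrite /coord /=.
- by apply: (continuous_comp (f := fst) (g := fst)); exact: cvg_fst.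
- by apply: (continuous_comp (f := fst) (g := snd)); [exact: cvg_fst|exact: cvg_snd].
- exact: cvg_snd.
Qed.

Lemma continuous_sqnorm3 : continuous (@sqnorm3 R).
Proof.
pose i0 : 'I_3 := @Ordinal 3 0 isT; pose i1 : 'I_3 := @Ordinal 3 1 isT.
pose i2 : 'I_3 := @Ordinal 3 2 isT.
have -> : @sqnorm3 R = fun p => coord i0 p * coord i0 p + coord i1 p * coord i1 p + coord i2 p * coord i2 p.
  by apply/funext => p; rewrite /sqnorm3 /coord /= !expr2.
move=> p; have c i := @continuous_coord i p.
by apply: cvgD; [apply: cvgD|]; apply: cvgM; exact: c.
Qed.

Lemma diffn_derive1n g n k : (forall n, diffn n g) -> diffn k (g^`(n))%classic.
Proof.
elim: n g k => [|n IH] g k cg; first exact: cg.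
by rewrite derive1Sn; apply: IH => m; case: (cg m.+1).
Qed.

Definition has_partial (u : R3 R -> R) i (u' : R3 R -> R) :=
  forall p, is_derive (coord i p) (1:R) (fun t => u (setc i p t)) (u' p).

Lemma has_partial_radial g g' i : (forall s, is_derive s (1:R) g (g' s)) ->
  has_partial (fun p => g (sqnorm3 p)) i (fun p => g' (sqnorm3 p) * (2 * coord i p)).
Proof.
move=> dg p.
have d1 : is_derive (coord i p) (1:R) (fun t => sqnorm3 (setc i p t)) (2 * coord i p).
  have -> : (fun t => sqnorm3 (setc i p t)) = fun t => t ^+ 2 + (sqnorm3 p - coord i p ^+ 2).
    by apply/funext => t; rewrite sqnorm3_setc.
  by apply: (is_derive_add (is_derive_pow 2 _) (is_derive_cst _ _ _)); rewrite addr0.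
by apply: (is_derive_compose (g := fun t => sqnorm3 (setc i p t)) (dg _) d1); rewrite setc_coord.
Qed.

Lemma has_partialM u u' v v' i : has_partial u i u' -> has_partial v i v' ->
  has_partial (fun p => u p * v p) i (fun p => u' p * v p + u p * v' p).
Proof.
move=> du dv p; apply: (is_derive_mul (du p) (dv p)).
by rewrite /= setc_coord.
Qed.

Lemma has_partialD u u' v v' i : has_partial u i u' -> has_partial v i v' ->
  has_partial (fun p => u p + v p) i (fun p => u' p + v' p).
Proof. by move=> du dv p; apply: (is_derive_add (du p) (dv p)). Qed.

Lemma has_partial_coord i j : has_partial (coord j) i (fun=> (j == i)%:R).
Proof.
move=> p; have -> : (fun t => coord j (setc i p t)) = if j == i then id else fun=> coord j p.
  by apply/funext => t; rewrite coord_setc; case: eqP.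
by case: eqP => _; [exact: is_derive_id|exact: is_derive_cst].
Qed.

Lemma has_partial_partial u u' i : has_partial u i u' -> partial i u = u'.
Proof.
move=> h; apply/funext => p; rewrite /partial derive1E.
exact: (@derive_val _ _ _ _ _ _ _ (h p)).
Qed.

Lemma radial_algebra_partial g u i : (forall n, diffn n g) -> radial_algebra g u ->
  exists2 u', radial_algebra g u' & has_partial u i u'.
Proof.
move=> cg; elim=> {u} [n|j|c|u v _ [u' ru du] _ [v' rv dv]|u v hu [u' ru du] hv [v' rv dv]].
- exists (fun p => (g^`(n.+1))%classic (sqnorm3 p) * (2 * coord i p)).
    by do 2 ?[apply: RA_mul]; [exact: RA_derive|exact: RA_cst|exact: RA_coord].
  apply: has_partial_radial => s; rewrite derive1nS.
  exact: diffn_is_derive (diffn_derive1n n 1 cg).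
- by exists (fun=> (j == i)%:R); [exact: RA_cst|exact: has_partial_coord].
- by exists (fun=> 0); [exact: RA_cst|move=> p; exact: is_derive_cst].
- by exists (fun p => u' p + v' p); [exact: RA_add|exact: has_partialD].
- exists (fun p => u' p * v p + u p * v' p); last exact: has_partialM.
  by apply: RA_add; exact: RA_mul.
Qed.

Lemma radial_algebra_continuous g u : (forall n, diffn n g) -> radial_algebra g u -> continuous u.
Proof.
move=> cg; elim=> {u} [n|j|c|u v _ cu _ cv|u v _ cu _ cv] p.
- apply: (continuous_comp (f := @sqnorm3 R)); first exact: continuous_sqnorm3.
  exact: (diffn_derive1n n 0 cg).
- exact: continuous_coord.
- exact: cst_continuous.
- exact: cvgD (cu p) (cv p).
- exact: cvgM (cu p) (cv p).
Qed.

Lemma smooth_radial g : (forall n, diffn n g) -> smooth (fun p => g (sqnorm3 p)).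
Proof.
move=> cg l.
have : radial_algebra g (iter_partials l (fun p => g (sqnorm3 p))).
  elim: l => [|i l IH] /=; first exact: (RA_derive g 0).
  have [u' ru hu] := radial_algebra_partial i cg IH.
  by rewrite /iter_partials /= -/(iter_partials _ _) (has_partial_partial hu).
move=> rl; split; first exact: radial_algebra_continuous rl.
move=> i p; have [u' _ hu] := radial_algebra_partial i cg rl.
by have := hu p => ?; exact: ex_derive.
Qed.

Lemma laplacian_radial g : diffn 2 g ->
  laplacian (fun p : R3 R => g (sqnorm3 p)) = fun p => radial_laplacian g (sqnorm3 p).
Proof.
move=> cg; have cg1 : diffn 1 (g^`())%classic by case: cg.
have d2 i : partial i (partial i (fun p : R3 R => g (sqnorm3 p))) = fun p =>
    4 * (g^`()^`())%classic (sqnorm3 p) * coord i p ^+ 2 + 2 * (g^`())%classic (sqnorm3 p).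
  rewrite (has_partial_partial (has_partial_radial i (fun s => diffn_is_derive s cg))).
  have hc : has_partial (fun p => 2 * coord i p) i (fun=> 2).
    move=> p; apply: (is_derive_scale (k := 2) (has_partial_coord i i p)).
    by rewrite eqxx mulr1.
  rewrite (has_partial_partial (has_partialM (has_partial_radial i (fun s => diffn_is_derive s cg1)) hc)).
  have e (a b c : R) : a * (2 * c) * (2 * c) + b * 2 = 4 * a * c ^+ 2 + 2 * b by ring.
  by apply/funext => p; exact: e.
apply/funext => p; rewrite /laplacian !big_ord_recl big_ord0 !d2.
rewrite /radial_laplacian; move: (g^`()^`()%classic _) (g^`()%classic _) => a b.
by rewrite /sqnorm3 /coord /=; ring.
Qed.

End Space.

(** * Integrals over three-space *)

(* The library's sigma-finite instance for product measures is shadowed by its subprobability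
   instance, so the structure is rebuilt on an alias. *)
Section SigmaFiniteAlias.
Context d (X : measurableType d) (R : realType) (m : {measure set X -> \bar R}).
Hypothesis sf : sigma_finite setT m.
Definition sf_alias of sigma_finite setT m : set X -> \bar R := m.
Local Notation m' := (sf_alias sf).
HB.instance Definition _ := Measure.copy m' m.
HB.instance Definition _ := Measure_isSigmaFinite.Build _ _ _ m' sf.
End SigmaFiniteAlias.

Lemma tonelli_sigma_finite d1 d2 (X : measurableType d1) (Y : measurableType d2) (R : realType)
  (m1 : {measure set X -> \bar R}) (m2 : {sigma_finite_measure set Y -> \bar R})
  (f : X * Y -> \bar R) : sigma_finite setT m1 ->
  measurable_fun setT f -> (forall p, 0 <= f p)%E ->
  (\int[m1 \x m2]_p f p = \int[m1]_x \int[m2]_y f (x, y))%E.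
Proof.
(* [sf_alias sf] unfolds to [m1], so the identity for the alias is convertible to the goal. *)
move=> sf mf f0; have e : (\int[sf_alias sf \x m2]_p f p = \int[sf_alias sf]_x \int[m2]_y f (x, y))%E.
  exact: fubini_tonelli1.
exact: e.
Qed.

Lemma sigma_finite_prod d1 d2 (X : measurableType d1) (Y : measurableType d2) (R : realType)
  (m1 : {sigma_finite_measure set X -> \bar R}) (m2 : {sigma_finite_measure set Y -> \bar R}) :
  sigma_finite setT (m1 \x m2)%E.
Proof.
have /sigma_finiteP[F [TF ndF Foo]] := sigma_finiteT m1.
have /sigma_finiteP[G [TG ndG Goo]] := sigma_finiteT m2.
exists (fun n => F n `*` G n)%classic.
  rewrite -setXTT TF TG predeqE => -[x y]; split.
    move=> [/= [n _ Fnx] [k _ Gky]]; exists (maxn n k) => //; split.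
    - by move: x Fnx; exact/subsetPset/ndF/leq_maxl.
    - by move: y Gky; exact/subsetPset/ndG/leq_maxr.
  by move=> [n _ []/= ? ?]; split; exists n.
move=> k; have [? ?] := Foo k; have [? ?] := Goo k.
split; first exact: measurableX.
by rewrite product_measure1E// lte_mul_pinfty// ge0_fin_numE.
Qed.

Lemma tonelli3 (R : realType) (f : R3 R -> \bar R) :
  measurable_fun setT f -> (forall p, 0 <= f p)%E ->
  (\int[lebesgue3 R]_p f p =
   \int[@lebesgue_measure R]_x \int[@lebesgue_measure R]_y \int[@lebesgue_measure R]_z f (x, y, z))%E.
Proof.
move=> mf f0.
have sf : sigma_finite setT (@lebesgue_measure R \x @lebesgue_measure R)%E.
  exact: sigma_finite_prod.
have e := tonelli_sigma_finite (@lebesgue_measure R) sf mf f0.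
rewrite /lebesgue3 e.
apply: (@fubini_tonelli1 _ _ _ _ R lebesgue_measure lebesgue_measure (fun q => \int[lebesgue_measure]_z f (q, z))%E).
- exact: measurable_fun_fubini_tonelli_F.
- by move=> q /=; apply: integral_ge0 => z _; exact: f0.
Qed.

(** * Integrability of the inverse square of the profile *)

Section Integral.
Context {R : realType}.
Implicit Types (f g : R -> R).
Local Notation mu := (@lebesgue_measure R).
Local Notation mu3 := (lebesgue3 R).
Local Open Scope ereal_scope.

Lemma measurable_radial g : continuous g ->
  measurable_fun setT (fun p : R3 R => g (sqnorm3 p)).
Proof.
move=> cg; apply: measurableT_comp; first exact: continuous_measurable_fun.
rewrite /sqnorm3; apply: measurable_funD; [apply: measurable_funD|]; apply: measurable_funX.
- by apply: (measurableT_comp (f := fst)); exact: measurable_fst.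
- by apply: (measurableT_comp (f := snd)); [exact: measurable_snd|exact: measurable_fst].
- exact: measurable_snd.
Qed.

Lemma integral_inv_oneDsqr : \int[mu]_x ((1 + x ^+ 2)^-1)%:E = pi%:E.
Proof.
rewrite ge0_symfun_integralT.
- have -> : [set x : R | (0 <= x)%R]%classic = `[0%R, +oo[%classic.
    by apply/seteqP; split=> x /=; rewrite in_itv /= andbT.
  have := @integral0y_oneDsqr R; rewrite /oneDsqr => ->.
  by rewrite -EFinM; congr EFin; field.
- by move=> x; rewrite invr_ge0 addr_ge0 // sqr_ge0.
- by move=> x; apply: continuous_oneDsqrV.
- by move=> x /=; rewrite sqrrN.
Qed.

Lemma measurable_inv_oneDsqr : measurable_fun setT (fun x : R => ((1 + x ^+ 2)^-1)%R).
Proof. by apply: continuous_measurable_fun; exact: continuous_oneDsqrV. Qed.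

Lemma integralZ_inv_oneDsqr (k : R) : (0 <= k)%R ->
  \int[mu]_x (k * (1 + x ^+ 2)^-1)%:E = (k * pi)%:E.
Proof.
move=> k0; under eq_integral do rewrite EFinM.
rewrite ge0_integralZl //; first by rewrite integral_inv_oneDsqr.
- apply/measurable_EFinP; exact: measurable_inv_oneDsqr.
- by move=> x _; rewrite lee_fin invr_ge0 addr_ge0 // sqr_ge0.
Qed.

(** A product majorant: by Tonelli its integral splits into three one-dimensional ones, so polar
    coordinates are avoided. *)
Definition oneDsqr3 (p : R3 R) : R :=
  ((1 + p.1.1 ^+ 2)^-1 * (1 + p.1.2 ^+ 2)^-1 * (1 + p.2 ^+ 2)^-1)%R.

Lemma oneDsqr3_ge0 p : (0 <= oneDsqr3 p)%R.
Proof. by rewrite /oneDsqr3 !mulr_ge0 ?invr_ge0 ?addr_ge0 ?sqr_ge0. Qed.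

Lemma measurable_oneDsqr3 : measurable_fun setT oneDsqr3.
Proof.
have ma := measurable_inv_oneDsqr.
apply: measurable_funM; [apply: measurable_funM|]; apply: (measurableT_comp ma).
- by apply: (measurableT_comp (f := fst)); exact: measurable_fst.
- by apply: (measurableT_comp (f := snd)); [exact: measurable_snd|exact: measurable_fst].
- exact: measurable_snd.
Qed.

Lemma integral3_oneDsqr3 : \int[mu3]_p (oneDsqr3 p)%:E = (pi * pi * pi)%:E.
Proof.
have a0 (x : R) : (0 <= (1 + x ^+ 2)^-1)%R by rewrite invr_ge0 addr_ge0 // sqr_ge0.
rewrite tonelli3; last 2 first.
- by apply/measurable_EFinP; exact: measurable_oneDsqr3.
- by move=> p; rewrite lee_fin oneDsqr3_ge0.
have pi0 : (0 <= pi :> R)%R := pi_ge0 R.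
transitivity (\int[mu]_x (pi * pi * (1 + x ^+ 2)^-1)%:E); last first.
  by rewrite integralZ_inv_oneDsqr // mulr_ge0.
apply: eq_integral => x _.
transitivity (\int[mu]_y ((pi * (1 + x ^+ 2)^-1) * (1 + y ^+ 2)^-1)%:E); last first.
  by rewrite integralZ_inv_oneDsqr ?mulr_ge0 // mulrAC.
apply: eq_integral => y _.
by rewrite /oneDsqr3 /= integralZ_inv_oneDsqr ?mulr_ge0 //; congr EFin; ring.
Qed.

Variable eta : R.
Hypotheses (eta_gt0 : (0 < eta)%R) (eta_le1 : (eta <= 1)%R).
Local Notation P := (profile eta).

Definition weight (p : R3 R) : R := ((P (sqnorm3 p) ^+ 2)^-1)%R.

Lemma continuous_inv_sqr g : (forall s, 0 < g s)%R -> continuous g ->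
  continuous (fun s => (g s ^+ 2)^-1)%R.
Proof.
move=> g0 cg; apply: (@diffnV _ 0); first by move=> x; rewrite gt_eqF // exprn_gt0.
exact: (@diffnX _ 0).
Qed.

Lemma measurable_inv_sqr g : (forall s, 0 < g s)%R -> continuous g ->
  measurable_fun setT (fun p : R3 R => (g (sqnorm3 p) ^+ 2)^-1)%R.
Proof. by move=> g0 cg; exact: (measurable_radial (continuous_inv_sqr g0 cg)). Qed.

(** From [(1 + s)^2 <= 10 + 10 (1 - s)^2] and [eta <= 1], [P] is at least [(eta^2 / 10) (1 + s)^2].
    Squaring gives [(1 + s)^4], which dominates the product of the three factors
    [1 + x_i^2 <= 1 + s]. *)
Lemma weight_le : exists2 C : R, (0 <= C)%R & forall p, (weight p <=
  C * oneDsqr3 p)%R.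
Proof.
have e2 : (0 < eta ^+ 2)%R by rewrite exprn_gt0.
exists ((10 / eta ^+ 2) ^+ 2)%R; first by rewrite exprn_ge0 // divr_ge0 // ltW.
move=> [[x y] z]; rewrite /weight /oneDsqr3 /sqnorm3 /=.
set s := (_ + _)%R; have P0 := profile_gt0 eta_gt0 s.
have s0 : (0 <= s)%R by rewrite !addr_ge0 // sqr_ge0.
have h1 : ((1 + s) ^+ 2 <= 10 / eta ^+ 2 * P s)%R.
  have -> : (10 / eta ^+ 2 * P s = 10 + 10 / eta ^+ 2 * (1 - s) ^+ 2)%R.
    by rewrite /profile; field; rewrite gt_eqF.
  have h : (10 * (1 - s) ^+ 2 <= 10 / eta ^+ 2 * (1 - s) ^+ 2)%R.
    rewrite ler_wpM2r ?sqr_ge0 // ler_pdivlMr // -[leRHS]mulr1 ler_wpM2l //.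
    by rewrite exprn_ile1 // ltW.
  apply: le_trans (lerD (lexx _) h).
  have := sqr_ge0 (s - 3)%R; have := sqr_ge0 (1 - s)%R; nra.
have h2 : ((1 + x ^+ 2) * (1 + y ^+ 2) * (1 + z ^+ 2) <= (1 + s) ^+ 4)%R.
  have e a : (0 <= a ^+ 2 :> R)%R by exact: sqr_ge0.
  have l a : (a ^+ 2 <= s)%R -> (1 + a ^+ 2 <= 1 + s)%R by rewrite lerD2l.
  have e1 a : (0 <= 1 + a ^+ 2 :> R)%R by rewrite addr_ge0 // e.
  have ex := e x; have ey := e y; have ez := e z.
  have x1 : (x ^+ 2 <= s)%R by rewrite /s; lra.
  have y1 : (y ^+ 2 <= s)%R by rewrite /s; lra.
  have z1 : (z ^+ 2 <= s)%R by rewrite /s; lra.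
  apply: (@le_trans _ _ ((1 + s) * (1 + s) * (1 + s))%R).
    by apply: ler_pM; rewrite ?mulr_ge0 ?e1 ?l //; apply: ler_pM; rewrite ?e1 ?l.
  have -> : ((1 + s) ^+ 4 = (1 + s) * (1 + s) * (1 + s) * (1 + s))%R by ring.
  have c0 : (0 <= (1 + s) * (1 + s) * (1 + s))%R by rewrite !mulr_ge0 // addr_ge0.
  nra.
have h3 : ((1 + s) ^+ 4 <= (10 / eta ^+ 2) ^+ 2 * P s ^+ 2)%R.
  have -> : ((1 + s) ^+ 4 = ((1 + s) ^+ 2) ^+ 2)%R by rewrite -exprM.
  rewrite -exprMn; apply: lerXn2r; rewrite ?nnegrE ?sqr_ge0 //.
  by rewrite mulr_ge0 ?divr_ge0 // ltW.
have d a : (0 < 1 + a ^+ 2 :> R)%R by rewrite ltr_pwDl // sqr_ge0.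
rewrite -!invfM ler_pdivlMr; last by rewrite !mulr_gt0.
by rewrite ler_pdivrMl ?exprn_gt0 // (le_trans h2) // [leRHS]mulrC.
Qed.

Lemma weight_ge0 p : (0 <= weight p)%R.
Proof. by rewrite invr_ge0 sqr_ge0. Qed.

Lemma integrable_weight : mu3.-integrable setT (EFin \o weight).
Proof.
have mw : measurable_fun setT weight.
  apply: measurable_inv_sqr; [exact: profile_gt0|exact: (profile_smooth eta 0)].
apply/integrableP; split; first by apply/measurable_EFinP.
have [C C0 hC] := weight_le.
have q0 := oneDsqr3_ge0; have mq := measurable_oneDsqr3.
apply: (@le_lt_trans _ _ (\int[mu3]_p (C%:E * (oneDsqr3 p)%:E))).
  apply: ge0_le_integral => //.
  - by apply: measurableT_comp => //; by apply/measurable_EFinP.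
  - by apply/measurable_EFinP; apply: measurable_funM => //.
  - by move=> p _; rewrite /= -EFinM lee_fin ger0_norm ?weight_ge0.
rewrite ge0_integralZl //; last 2 first.
- by apply/measurable_EFinP.
- by move=> p _; rewrite lee_fin.
by rewrite integral3_oneDsqr3 -EFinM ltry.
Qed.

End Integral.

(** * Lower bound for the integral of the inverse square of the profile *)

Section WeightBounds.
Context {R : realType}.
Local Notation mu := (@lebesgue_measure R).
Local Notation mu3 := (lebesgue3 R).
Local Open Scope ereal_scope.

Lemma integral_ge_itv (F : R -> \bar R) (a b k : R) : measurable_fun setT F ->
  (forall x, 0 <= F x) -> (a <= b)%R -> (0 <= k)%R ->
  (forall x, (a <= x <= b)%R -> k%:E <= F x) -> (k * (b - a))%:E <= \int[mu]_x F x.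
Proof.
move=> mF F0 ab k0 kF.
apply: (@le_trans _ _ (\int[mu]_(x in `[a, b]) F x)); last first.
  by apply: ge0_subset_integral.
apply: (@le_trans _ _ (\int[mu]_(x in `[a, b]) k%:E)).
  rewrite integral_cst //= lebesgue_measure_itv /= lte_fin.
  have [ab'|ba] := ltP a b; first by rewrite -EFinB -EFinM.
  have -> : b = a by apply/eqP; rewrite eq_le ba ab.
  by rewrite subrr mulr0 mule0.
by apply: ge0_le_integral => //; exact: measurable_funTS.
Qed.

Lemma measurable_integral_section d (X : measurableType d) (F : X * R -> \bar R) :
  measurable_fun setT F -> (forall p, 0 <= F p) ->
  measurable_fun setT (fun x => \int[mu]_y F (x, y)).
Proof. by move=> mF F0; exact: measurable_fun_fubini_tonelli_F. Qed.

Variable eta : R.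
Hypotheses (eta_gt0 : (0 < eta)%R) (eta_le1 : (eta <= 1)%R).
Local Notation W := (@weight R eta).

(* On the shell [| |p|^2 - 1 | <= eta] the weight is at least [(2 eta^2)^-2];
   above each point of [[0, 1/2]^2] the shell contains a vertical segment of length [eta / 4]. *)
Lemma weight_ge_shell (x y z : R) : (0 <= x <= 2^-1)%R -> (0 <= y <= 2^-1)%R ->
  (Num.sqrt (1 - x ^+ 2 - y ^+ 2) <= z <= Num.sqrt (1 - x ^+ 2 - y ^+ 2) + eta / 4)%R ->
  ((4 * eta ^+ 4)^-1 <= W (x, y, z))%R.
Proof.
move=> /andP[x0 x1] /andP[y0 y1].
have : (Num.sqrt (1 - x ^+ 2 - y ^+ 2) ^+ 2 = 1 - x ^+ 2 - y ^+ 2)%R.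
  by rewrite sqr_sqrtr //; nra.
move: (Num.sqrt _) (sqrtr_ge0 (1 - x ^+ 2 - y ^+ 2)) => a a0 a2 /andP[z0 z1].
have a1 : (a <= 1)%R.
  have := sqr_ge0 x; have := sqr_ge0 y; rewrite -(@expr_le1 _ 2) // a2; lra.
rewrite /weight /sqnorm3 /=; set s := (_ + _)%R.
(* [s - 1 = z^2 - a^2] is at most [(eta / 4) * 3], because [2 a + (z - a) <= 2 + 1/4]. *)
have s1 : (0 <= s - 1 <= eta)%R.
  have -> : (s - 1 = (z - a) * (2 * a + (z - a)))%R.
    have -> : ((z - a) * (2 * a + (z - a)) = z ^+ 2 - a ^+ 2)%R by ring.
    by rewrite a2 /s; ring.
  have d0 : (0 <= z - a)%R by lra.
  have d1 : (z - a <= eta / 4)%R by lra.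
  have h2 : (2 * a + (z - a) <= 3)%R by have := eta_le1; lra.
  have h0 : (0 <= 2 * a + (z - a))%R by lra.
  rewrite mulr_ge0 //= (le_trans (ler_pM d0 h0 d1 h2)) //; lra.
have P0 := profile_gt0 eta_gt0 s.
have e4 : (4 * eta ^+ 4 = (2 * eta ^+ 2) ^+ 2)%R by ring.
rewrite e4 lef_pV2 ?posrE ?exprn_gt0 //; last by rewrite mulr_gt0 // exprn_gt0.
apply: lerXn2r; rewrite ?nnegrE.
- exact: ltW.
- by rewrite mulr_ge0 // sqr_ge0.
- by rewrite /profile; move: s1 => /andP[? ?]; nra.
Qed.

(** The shell bound [1 / (4 eta^4)] times the volume [(eta / 4) * (1/2) * (1/2)] of a region inside
    the shell, one coordinate at a time. *)
Lemma integral_weight_ge : ((64 * eta ^+ 3)^-1)%:E <= \int[mu3]_p (W p)%:E.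
Proof.
have W0 p : 0 <= (W p)%:E by rewrite lee_fin weight_ge0.
have mW : measurable_fun setT (fun p => (W p)%:E).
  by apply/measurable_EFinP; apply: measurable_inv_sqr; [exact: profile_gt0|exact: (profile_smooth eta 0)].
rewrite tonelli3 //.
pose G (q : R * R) := \int[mu]_z (W (q, z))%:E.
have G0 q : 0 <= G q by apply: integral_ge0.
have mG : measurable_fun setT G.
  exact: (measurable_integral_section mW W0).
pose H x := \int[mu]_y G (x, y).
have H0 x : 0 <= H x by apply: integral_ge0.
have mH : measurable_fun setT H.
  exact: (measurable_integral_section mG G0).
have half : (0 <= 2^-1 :> R)%R by [].
have p4 : (0 <= (4 * eta ^+ 4)^-1)%R by rewrite invr_ge0 mulr_ge0 // exprn_ge0 // ltW.
have k0 : (0 <= (4 * eta ^+ 4)^-1 * (eta / 4))%R by rewrite mulr_ge0 // divr_ge0 // ltW.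
have -> : ((64 * eta ^+ 3)^-1 = (4 * eta ^+ 4)^-1 * (eta / 4) * (2^-1 - 0) * (2^-1 - 0))%R.
  by field; rewrite gt_eqF.
apply: (@integral_ge_itv H) => //; first by rewrite mulr_ge0 // subr0.
move=> x xI; apply: (@integral_ge_itv (fun y => G (x, y))) => //.
  exact: (measurableT_comp mG (measurable_pair1 _)).
move=> y yI; set a := Num.sqrt (1 - x ^+ 2 - y ^+ 2).
have -> : (eta / 4 = (a + eta / 4) - a)%R by ring.
apply: (@integral_ge_itv (fun z => (W (x, y, z))%:E)) => //.
- exact: (measurableT_comp mW (measurable_pair1 _)).
- by rewrite lerDl divr_ge0 // ltW.
- by move=> z zI; rewrite lee_fin; exact: weight_ge_shell.
Qed.

End WeightBounds.

(** * Masses of functions close to the profile *)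

Section TotalMass.
Context {R : realType}.
Local Notation mu3 := (lebesgue3 R).
Variable eta : R.
Hypothesis (eta_gt0 : 0 < eta).
Hypothesis (eta_le1 : eta <= 1).
Local Notation P := (profile eta).
Implicit Types g h : R -> R.

Definition mass g : R := (\int[mu3]_p ((g (sqnorm3 p) ^+ 2)^-1))%R.

Definition near_profile g := continuous g /\ forall s, `|g s - P s| <= P s / 2.

Lemma near_profile_bounds g s : near_profile g -> P s / 2 <= g s /\ g s <= 3 / 2 * P s.
Proof. by move=> [_ h]; have := h s; rewrite ler_norml => /andP[]; split; lra. Qed.

Lemma near_profile_gt0 g s : near_profile g -> 0 < g s.
Proof.
move=> /(near_profile_bounds s)[h _]; apply: lt_le_trans h.
by rewrite divr_gt0 // profile_gt0.
Qed.

Lemma near_profile_sqr g s : near_profile g ->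
  4 / 9 * (P s ^+ 2)^-1 <= (g s ^+ 2)^-1 /\ (g s ^+ 2)^-1 <= 4 * (P s ^+ 2)^-1.
Proof.
move=> ng; have g0 := near_profile_gt0 s ng; have P0 := profile_gt0 eta_gt0 s.
have [h1 h2] := near_profile_bounds s ng.
have p2 : 0 < P s ^+ 2 by rewrite exprn_gt0.
have g2 : 0 < g s ^+ 2 by rewrite exprn_gt0.
split.
- by rewrite ler_pdivrMr // ler_pdivlMl //; nra.
- by rewrite ler_pdivlMr // ler_pdivrMl //; nra.
Qed.

Lemma near_profile_integrable g : near_profile g ->
  mu3.-integrable setT (EFin \o fun p => (g (sqnorm3 p) ^+ 2)^-1).
Proof.
move=> ng; have g0 s := near_profile_gt0 s ng.
have iW := integrableZl measurableT 4 (integrable_weight eta_gt0 eta_le1).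
apply: (le_integrable _ _ _ iW) => //.
- by apply/measurable_EFinP; apply: measurable_inv_sqr => //; case: ng.
- move=> p _; rewrite /= lee_fin [leLHS]ger0_norm ?invr_ge0 ?sqr_ge0 //.
  rewrite ger0_norm ?mulr_ge0 ?weight_ge0 //.
  by have [] := near_profile_sqr (sqnorm3 p) ng.
Qed.

Lemma mass_ge g : near_profile g -> 4 / 9 * (64 * eta ^+ 3)^-1 <= mass g.
Proof.
move=> ng; have iW := integrable_weight eta_gt0 eta_le1.
apply: (@le_trans _ _ (\int[mu3]_p (4 / 9 * weight eta p))%R).
  rewrite RintegralZl // ler_wpM2l ?divr_ge0 // -lee_fin /Rintegral fineK.
    exact: integral_weight_ge.
  exact: integrable_fin_num iW.
apply: le_Rintegral => //.
- by have := integrableZl measurableT (4 / 9) iW; under eq_fun do rewrite -EFinM.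
- exact: near_profile_integrable.
- by move=> p _; have [] := near_profile_sqr (sqnorm3 p) ng.
Qed.

(** Same factorisation as for [icube_dist], now with two monomials of degree 3, each at most
    [(2 / p)^3]; hence 16 = 2 * 8. *)
Lemma inv_sqr_dist (p a b c : R) : 0 < p -> p / 2 <= a -> p / 2 <= b -> `|a - b| <= c * p ->
  `|(a ^+ 2)^-1 - (b ^+ 2)^-1| <= 16 * c * (p ^+ 2)^-1.
Proof.
move=> p0 pa pb ab.
have a0 : 0 < a by lra.
have b0 : 0 < b by lra.
have h (y : R) : p / 2 <= y -> 0 < y -> 0 <= y^-1 <= 2 / p.
  by move=> py y0; rewrite invr_ge0 ltW //= -[2 / p]invf_div lef_pV2 // posrE divr_gt0.
have /andP[x0 x2] := h a pa a0; have /andP[y0 y2] := h b pb b0.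
have -> : (a ^+ 2)^-1 - (b ^+ 2)^-1 =
    (b - a) * (a^-1 * (b^-1) ^+ 2 + (a^-1) ^+ 2 * b^-1).
  by field; rewrite !gt_eqF.
have e (z : R) : 0 <= z -> z <= 2 / p -> z ^+ 2 <= (2 / p) ^+ 2.
  by move=> z0 z2; apply: lerXn2r => //; rewrite nnegrE // (le_trans z0).
have -> : 16 * c * (p ^+ 2)^-1 = (c * p) * ((2 / p) * (2 / p) ^+ 2 + (2 / p) ^+ 2 * (2 / p)).
  by field; rewrite gt_eqF.
rewrite normrM distrC ler_pM //.
rewrite ger0_norm; last by rewrite addr_ge0 // mulr_ge0 // sqr_ge0.
by rewrite lerD // ler_pM // ?sqr_ge0 // e.
Qed.

Lemma mass_dist g h (c : R) : near_profile g -> near_profile h ->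
  (forall s, `|g s - h s| <= c * P s) ->
  `|mass g - mass h| <= 16 * c * (\int[mu3]_p weight eta p)%R.
Proof.
move=> ng nh gh; have ig := near_profile_integrable ng; have ih := near_profile_integrable nh.
have iW := integrable_weight eta_gt0 eta_le1.
have igh : mu3.-integrable setT (EFin \o fun p => (g (sqnorm3 p) ^+ 2)^-1 - (h (sqnorm3 p) ^+ 2)^-1).
  by have := integrableB measurableT ig ih; under eq_fun do rewrite -EFinB.
rewrite /mass -RintegralB // (le_trans (le_normr_Rintegral _ igh)) // -RintegralZl //.
apply: le_Rintegral => //.
- exact: (integrable_norm igh).
- by have := integrableZl measurableT (16 * c) iW; under eq_fun do rewrite -EFinM.
- move=> p _; apply: inv_sqr_dist => //; first exact: profile_gt0.
  + by have [] := near_profile_bounds (sqnorm3 p) ng.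
  + by have [] := near_profile_bounds (sqnorm3 p) nh.
Qed.

End TotalMass.

(** * Prescribing the mass *)

Section Family.
Context {R : realType}.
Variable z : R.
Hypothesis z_gt0 : 0 < z.
Hypothesis z_le1 : z <= 1.
(** With a fourth power here, [dmax = eta^5 / 16] has the fourth root [z^5 / 2], and no roots have
    to be taken. The divisor 16 gives [dmax * B = 1 / 240], below the required 1/96. *)
Let eta := z ^+ 4.
Local Notation P := (profile eta).
Let B : R := (eta ^+ 5)^-1 / 15.
Let dmax : R := z ^+ 20 / 16.

Let eta_gt0 : 0 < eta. Proof. exact: exprn_gt0. Qed.
Let eta_le1 : eta <= 1. Proof. by apply: exprn_ile1 => //; exact: ltW. Qed.
Let B_ge0 : 0 <= B. Proof. by rewrite divr_ge0 // invr_ge0 exprn_ge0 // ltW. Qed.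
Let KP s : `|inv_lap3 (icube P) s| <= B * P s. Proof. exact: inv_lap3_profile_le. Qed.
Let eta2_gt0 : 0 < eta ^+ 2. Proof. exact: exprn_gt0. Qed.
Let dmax_ge0 : 0 <= dmax. Proof. by rewrite divr_ge0 // exprn_ge0 // ltW. Qed.

Lemma dmax_bound (d : R) : 0 <= d -> d <= dmax -> d * B <= 96^-1.
Proof.
move=> d0 dd; apply: (le_trans (ler_wpM2r B_ge0 dd)).
have -> : dmax * B = 240^-1 by rewrite /dmax /B /eta; field; rewrite gt_eqF.
by rewrite lef_pV2 ?posrE // ler_nat.
Qed.

Definition solves (d : R) (g : R -> R) :=
  [/\ (forall n, diffn n g), (forall s, `|g s - P s| <= P s / 2) & g =1 picard P d g].

Lemma solution_exists (d : R) : 0 <= d -> d <= dmax -> exists g, solves d g.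
Proof.
move=> d0 dd.
exact: (fixed_point_exists (profile_smooth eta) eta2_gt0 (profile_ge eta) KP d0 (dmax_bound d0 dd)).
Qed.

Lemma solves_near d g : solves d g -> near_profile eta g.
Proof. by move=> [cg gP _]; split => //; exact: (cg 0%N). Qed.

Lemma mass_lipschitz : exists2 L, 0 <= L & forall d d' g g', 0 <= d -> d <= dmax ->
  solves d g -> solves d' g' -> `|mass g - mass g'| <= L * `|d - d'|.
Proof.
set W := (\int[lebesgue3 R]_p weight eta p)%R.
have W0 : 0 <= W by apply: Rintegral_ge0 => p _; exact: weight_ge0.
exists (16 * (16 * B) * W); first by do 3?[apply: mulr_ge0 => //].
move=> d d' g g' d0 dd sg sg'.
have ng := solves_near sg; have ng' := solves_near sg'.
have [cg gP gT] := sg; have [cg' gP' gT'] := sg'.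
have h := fixed_point_lipschitz (profile_smooth eta) eta2_gt0 (profile_ge eta) B_ge0 KP
  d0 (dmax_bound d0 dd) gP gP' (cg 0%N) (cg' 0%N) gT gT'.
have := mass_dist eta_gt0 eta_le1 ng ng' h; rewrite -/W.
by congr (_ <= _); ring.
Qed.

(** The parameter is [c = d^(1/4)], the scalar by which [g] is finally divided, so the mass to
    prescribe is [F c = c^2 mass (g c)]. The intermediate value theorem applies between 0 and the
    fourth root of [dmax]. *)
Lemma mass_onto (Lambda : R) : 0 < Lambda -> Lambda <= (576 * z ^+ 2)^-1 ->
  exists (c : R) g, [/\ 0 < c, solves (c ^+ 4) g & c ^+ 2 * mass g = Lambda].
Proof.
(* Truncating at [dmax] makes a solution available for every real [c], so [g] can be chosen
   globally. The Lipschitz bound makes its mass continuous whatever the choice. *)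
move=> L0 Lz; pose d c : R := Num.min (c ^+ 4) dmax.
have d_ge0 c : 0 <= d c by rewrite le_min dmax_ge0 exprn_even_ge0.
have d_le c : d c <= dmax by rewrite ge_min lexx orbT.
have [g sg] := boolp.choice (fun c => solution_exists (d_ge0 c) (d_le c)).
have cd : continuous d.
  move=> x; have c4 : {for x, continuous (fun c : R => c ^+ 4)} by exact: exprn_continuous.
  exact: (continuous_min c4 (@cst_continuous _ _ dmax x)).
have [L Lge0 lip] := mass_lipschitz.
have cm : continuous (fun c => mass (g c)).
  move=> x; apply/cvgrPdist_lt => e e0.
  have e1 : 0 < e / (L + 1) by rewrite divr_gt0 // ltr_wpDl.
  have /cvgrPdist_lt/(_ _ e1) := cd x.
  apply: filterS => y hy; apply: (le_lt_trans (lip _ _ _ _ (d_ge0 x) (d_le x) (sg x) (sg y))).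
  apply: (@le_lt_trans _ _ ((L + 1) * `|d x - d y|)).
    by rewrite ler_wpM2r // lerDl.
  by rewrite mulrC -ltr_pdivlMr // ltr_wpDl.
pose F c := c ^+ 2 * mass (g c).
have cF : continuous F by apply: (@diffnM R 0) => //; exact/diffnX/diffn_id.
pose a := z ^+ 5 / 2.
have a0 : 0 < a by rewrite divr_gt0 // exprn_gt0.
have a4 : a ^+ 4 = dmax by rewrite /a /dmax; field.
have F0 : F 0 = 0 by rewrite /F expr0n /= mul0r.
have Fa : Lambda <= F a.
  apply: (le_trans Lz).
  have := mass_ge eta_gt0 eta_le1 (solves_near (sg a)) => hm.
  apply: (@le_trans _ _ (a ^+ 2 * (4 / 9 * (64 * eta ^+ 3)^-1))); last first.
    by rewrite ler_wpM2l // exprn_ge0 // ltW.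
  (* With [a^2 = z^10 / 4] and [eta^3 = z^12] the product is [z^-2 / (9 * 64)]; the negative power
     of [z] makes the mass unbounded as [z] tends to 0. *)
  suff -> : (576 * z ^+ 2)^-1 = a ^+ 2 * (4 / 9 * (64 * eta ^+ 3)^-1) by [].
  by rewrite /a /eta; field; rewrite gt_eqF.
have between : Num.min (F 0) (F a) <= Lambda <= Num.max (F 0) (F a).
  by rewrite F0 ge_min le_max (ltW L0) Fa orbT.
have [c] := IVT (ltW a0) (continuous_subspaceT cF) between.
rewrite in_itv /= => /andP[c0 ca] Fc.
have c_gt0 : 0 < c.
  rewrite lt_neqAle c0 andbT; apply/eqP => c_eq0; move: L0.
  by rewrite -Fc -c_eq0 F0 ltxx.
exists c, (g c); split=> //; have dc : d c = c ^+ 4.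
  by apply/min_idPl; rewrite -a4; apply: lerXn2r => //; rewrite nnegrE // ltW.
by rewrite -dc.
Qed.

End Family.

Unset Implicit Arguments.

Theorem theorem2 (R : realType) (Lambda : R) (hL : 0 < Lambda) :
  exists u : R3 R -> R,
    smooth u /\ radial u /\ (forall x, 0 < u x) /\
    (forall x, laplacian (laplacian (laplacian u)) x = - (u x ^+ 3)^-1) /\
    (\int[lebesgue3 R]_x ((u x ^+ 2)^-1)%:E = Lambda%:E)%E.
Proof.
(* Since 24^2 = 576, the attainable mass becomes [(1 + Lambda)^2], which exceeds [Lambda]. *)
pose z : R := (24 * (1 + Lambda))^-1.
have L1 : 0 < 1 + Lambda by lra.
have z_gt0 : 0 < z by rewrite invr_gt0 mulr_gt0.
have z_le1 : z <= 1 by rewrite invf_le1 ?mulr_gt0 //; lra.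
have Lz : Lambda <= (576 * z ^+ 2)^-1.
  have -> : (576 * z ^+ 2)^-1 = (1 + Lambda) ^+ 2 by rewrite /z; field; rewrite gt_eqF.
  nra.
have [c [g [c_gt0 sg mg]]] := mass_onto z_gt0 z_le1 hL Lz.
have eta_gt0 : 0 < z ^+ 4 by exact: exprn_gt0.
have eta_le1 : z ^+ 4 <= 1 by apply: exprn_ile1 => //; exact: ltW.
have ng := solves_near sg; have g0 s := near_profile_gt0 eta_gt0 s ng.
have [cg _ gT] := sg.
have cG n : diffn n (fun s => c^-1 * g s) by exact: diffnZ.
have rl (f : R -> R) : (forall n, diffn n f) -> forall n, diffn n (radial_laplacian f).
  by move=> cf n; exact/diffn_radial_laplacian/cf.
(* With [d = c^4] the scalar is consistent: [c^-1 c^4 g^-3 = (c^-1 g)^-3]. *)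
exists (fun p => c^-1 * g (sqnorm3 p)); split; [|split; [|split; [|split]]].
- exact: (smooth_radial cG).
- by move=> p q pq; rewrite pq.
- by move=> p; rewrite mulr_gt0 // invr_gt0.
- move=> p.
  rewrite (laplacian_radial (cG 2)) (laplacian_radial (rl _ cG 2)).
  rewrite (laplacian_radial (rl _ (rl _ cG) 2)).
  rewrite (radial_laplacianZ c^-1 (cg 2)) (radial_laplacianZ c^-1 (rl _ cg 2)).
  rewrite (radial_laplacianZ c^-1 (rl _ (rl _ cg) 2)).
  rewrite (radial_laplacian3_fixed_point cg g0 gT) /icube.
  have := g0 (sqnorm3 p); move: (g _) => y y0.
  by field; rewrite !gt_eqF.
- have e p : ((c^-1 * g (sqnorm3 p)) ^+ 2)^-1 = c ^+ 2 * (g (sqnorm3 p) ^+ 2)^-1.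
    by rewrite exprMn exprVn invfM invrK.
  under eq_integral do rewrite e EFinM.
  have ig := near_profile_integrable eta_gt0 eta_le1 ng.
  rewrite integralZl // -mg [RHS]EFinM; congr (_ * _)%E.
  by rewrite /mass /Rintegral fineK //; exact: integrable_fin_num ig.
Qed.
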